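(* (i) Let $G$ be any finite four-player binary XOR game. If $G$ has at most three active questions per player, then $$\omega_{\mathrm{co}}(G)=1\quad\Longleftrightarrow\quad G\text{ admits a perfect MERP strategy}.$$ (ii) There exists a four-player binary XOR game $G$, with four active questions per player, such that $\omega_{\mathrm{co}}(G)=1$ but $G$ admits no perfect MERP strategy. Consequently, four is the smallest number of active questions per player for which such a separation (commuting-operator value one without a perfect MERP strategy) can occur.
   Context: A finite four-player binary XOR game $G$ consists of finite question sets $Q_1,\dots,Q_4$ and a finite family of clauses $c$, each specified by a question tuple $q_c=(q_c^{(1)},\dots,q_c^{(4)})\in Q_1\times\cdots\times Q_4$, a weight $p_c\ge 0$ and a target parity $b_c\in\mathbb F_2$, with $\sum_c p_c=1$ (the same tuple may occur in several clauses). On clause $c$ the players return bits $a_1,\dots,a_4$ and win iff $a_1\oplus\cdots\oplus a_4=b_c$. A question of a player is active if it occurs in at least one clause with $p_c>0$. A commuting-operator strategy consists of a complex Hilbert space $\mathcal H$, a unit vector $\psi\in\mathcal H$, and bounded self-adjoint involutions $A_{\alpha,j}\in\mathcal B(\mathcal H)$ ($1\le\alpha\le4$, $j\in Q_\alpha$) such that $A_{\alpha,j}A_{\beta,k}=A_{\beta,k}A_{\alpha,j}$ whenever $\alpha\ne\beta$. Its success probability is $$V(G;\psi,A)=\sum_c\frac{p_c}{2}\Bigl(1+(-1)^{b_c}\bigl\langle\psi,\textstyle\prod_{\alpha=1}^4A_{\alpha,q_c^{(\alpha)}}\psi\bigr\rangle\Bigr),$$ and $\omega_{\mathrm{co}}(G)$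 is the supremum of $V(G;\psi,A)$ over all commuting-operator strategies. A MERP (GHZ-equatorial) strategy is given by angles $\theta_{\alpha,j}\in\mathbb R$: the players share $|\mathrm{GHZ}_4\rangle=(|0\rangle^{\otimes4}+|1\rangle^{\otimes4})/\sqrt2\in(\mathbb C^2)^{\otimes 4}$ and player $\alpha$ on question $j$ measures $M(\theta_{\alpha,j})=\cos\theta_{\alpha,j}\,X+\sin\theta_{\alpha,j}\,Y$ ($X,Y$ Pauli matrices) on its qubit, output bit $a$ corresponding to eigenvalue $(-1)^a$. It is perfect if it wins every clause of positive weight with certainty; equivalently $\sum_{\alpha=1}^4\theta_{\alpha,q_c^{(\alpha)}}=\pi b_c\pmod{2\pi}$ for every clause $c$ with $p_c>0$. *)

(* Defs.v *)
From HB Require Import structures.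
From mathcomp Require Import all_boot all_order all_algebra.
From mathcomp Require Import complex ring.
From mathcomp Require Import all_classical all_reals all_analysis.

Set Implicit Arguments.
Unset Strict Implicit.
Unset Printing Implicit Defensive.

Import Order.TTheory GRing.Theory Num.Theory.
Import numFieldNormedType.Exports.

Local Open Scope classical_set_scope.
Local Open Scope ring_scope.
Local Open Scope complex_scope.

Record xor_game (R : realType) := XorGame {
  question : 'I_4 -> finType;
  clause : finType;
  ask : clause -> forall a : 'I_4, question a;
  weight : clause -> R;
  target : clause -> bool;
  weight_ge0 : forall c, 0 <= weight c;
  weight_sum1 : \sum_c weight c = 1
}.

Definition active_questions (R : realType) (G : xor_game R) (a : 'I_4) :
    {set question G a} :=
  [set j | [exists c, (0 < weight c) && (ask c a == j)]]%SET.

(* A Banach space over the complex numbers whose norm comes from an inner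
   product. In {dot _ for Num.conj} the form is linear in its first argument
   and conjugate linear in the second one. *)
Record hilbertSpace (R : realType) := HilbertSpace {
  hilbert_sort :> completeNormedModType R[i];
  hdot : {dot hilbert_sort for Num.conj};
  hdotE : forall x : hilbert_sort, hdot x x = `|x| ^+ 2
}.

Definition bounded_op (R : realType) (H : hilbertSpace R)
    (A : {linear H -> H}) : Prop :=
  exists M : R, forall x : H, `|A x| <= M%:C * `|x|.

Definition self_adjoint (R : realType) (H : hilbertSpace R)
    (A : {linear H -> H}) : Prop :=
  forall x y : H, hdot H (A x) y = hdot H x (A y).

Record co_strategy (R : realType) (Q : 'I_4 -> finType) := CoStrategy {
  space : hilbertSpace R;
  state : space;
  obs : forall a : 'I_4, Q a -> {linear space -> space};
  state_unit : `|state| = 1;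
  obs_bounded : forall a j, bounded_op (@obs a j);
  obs_sa : forall a j, self_adjoint (@obs a j);
  obs_invol : forall a j (x : space), obs j (@obs a j x) = x;
  obs_comm : forall a b j k, a != b -> forall x : space,
    @obs a j (@obs b k x) = @obs b k (@obs a j x)
}.

Arguments obs {R Q} c {a} _.

Definition clause_op (R : realType) (G : xor_game R)
    (S : co_strategy R (question G)) (c : clause G) : space S -> space S :=
  \big[comp/id]_(a < 4) (obs S (ask c a) : space S -> space S).

Arguments clause_op {R G} S c _.

Definition clause_corr (R : realType) (G : xor_game R)
    (S : co_strategy R (question G)) (c : clause G) : R[i] :=
  hdot (space S) (state S) (clause_op S c (state S)).

(* The value of a strategy is a real number because the correlators are real;
   hence nothing is lost when taking the real part in [success]. *)
Lemma clause_corr_real (R : realType) (G : xor_game R)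
    (S : co_strategy R (question G)) (c : clause G) :
  clause_corr S c = (complex.Re (clause_corr S c))%:C.
Proof.
suff: (clause_corr S c)^* = clause_corr S c.
  case: (clause_corr S c) => x y /= -[Hy]; congr Complex.
  by move/eqP: Hy; rewrite eq_sym -subr_eq0 opprK -mulr2n mulrn_eq0 => /eqP.
rewrite /clause_corr; set psi := state S.
have -> : (hdot (space S) psi (clause_op S c psi))^* =
          hdot (space S) (clause_op S c psi) psi.
  by rewrite [RHS](hermitian_subproof (s := hdot (space S))) expr0 mul1r.
rewrite /clause_op !big_ord_recl big_ord0 /=.
have sa a j x y : hdot (space S) (@obs _ _ S a j x) y =
    hdot (space S) x (obs S j y) by exact: obs_sa.
rewrite !sa; congr (hdot _ _ _).
have C a b j k x : a != b -> @obs _ _ S a j (@obs _ _ S b k x) =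
    obs S k (obs S j x) by move=> ?; exact: obs_comm.
rewrite (C _ _ _ _ _ (_ : lift ord0 (lift ord0 (lift ord0 ord0)) != lift ord0 (lift ord0 ord0))) //.
rewrite (C _ _ _ _ (obs S _ _) (_ : lift ord0 (lift ord0 (lift ord0 ord0)) != lift ord0 ord0)) //.
rewrite (C _ _ _ _ _ (_ : lift ord0 (lift ord0 (lift ord0 ord0)) != ord0)) //.
rewrite (C _ _ _ _ _ (_ : lift ord0 (lift ord0 ord0) != lift ord0 ord0)) //.
rewrite (C _ _ _ _ _ (_ : lift ord0 (lift ord0 ord0) != ord0)) //.
rewrite (C _ _ _ _ _ (_ : lift ord0 ord0 != ord0)) //.
Qed.

Definition success (R : realType) (G : xor_game R)
    (S : co_strategy R (question G)) : R :=
  \sum_c weight c / 2 *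
    (1 + (-1) ^+ target c * complex.Re (clause_corr S c)).

Definition omega_co (R : realType) (G : xor_game R) : R :=
  sup [set v | exists S : co_strategy R (question G), v = success S].

Definition pauliX (R : realType) : 'M[R[i]]_2 :=
  \matrix_(i, j) (if i == j then 0 else 1).

Definition pauliY (R : realType) : 'M[R[i]]_2 :=
  \matrix_(i, j) (if i == j then 0 else if i == 0 then - 'i else 'i).

Definition equatorial (R : realType) (t : R) : 'M[R[i]]_2 :=
  (cos t)%:C *: pauliX R + (sin t)%:C *: pauliY R.

(* Projector onto the eigenspace of [equatorial t] for (-1) ^+ b; see the two
   lemmas below. *)
Definition equatorial_proj (R : realType) (t : R) (b : bool) : 'M[R[i]]_2 :=
  2^-1 *: (1%:M + (-1) ^+ b *: equatorial t).

Lemma equatorial_sqr (R : realType) (t : R) :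
  equatorial t *m equatorial t = 1%:M.
Proof.
apply/matrixP => i j; rewrite /equatorial /pauliX /pauliY !mxE.
rewrite !big_ord_recl big_ord0 !mxE.
have h : cos t * cos t + sin t * sin t = 1 by rewrite -!expr2 cos2Dsin2.
case: i => -[|[|//]] ?; case: j => -[|[|//]] ?;
  rewrite /= !(mulr0, mulr1, mul0r, addr0, add0r).
all: apply/eqP; rewrite eq_complex /= ?(mulr0, mulr1, mul0r, addr0, add0r, oppr0).
- by apply/andP; split; apply/eqP; [rewrite -[RHS]h|]; ring.
- by rewrite eqxx.
- by rewrite eqxx.
- by apply/andP; split; apply/eqP; [rewrite -[RHS]h|]; ring.
Qed.

Lemma equatorial_projP (R : realType) (t : R) (b : bool) :
  [/\ equatorial t *m equatorial_proj t b = (-1) ^+ b *: equatorial_proj t b,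
      equatorial_proj t b *m equatorial_proj t b = equatorial_proj t b
    & equatorial_proj t false + equatorial_proj t true = 1%:M].
Proof.
have E2 := equatorial_sqr t.
have s2 : ((-1) ^+ b * (-1) ^+ b : R[i]) = 1 by rewrite -expr2 sqrr_sign.
have two : (2 : R[i]) != 0 by rewrite pnatr_eq0.
have half (A : 'M[R[i]]_2) : 2^-1 *: (A + A) = A.
  by rewrite -mulr2n -[A *+ 2](scaler_nat 2 A) scalerA mulVf // scale1r.
have EP : equatorial t *m equatorial_proj t b = (-1) ^+ b *: equatorial_proj t b.
  rewrite /equatorial_proj -scalemxAr mulmxDr mulmx1 -scalemxAr E2.
  rewrite [RHS]scalerA [_ * 2^-1]mulrC -scalerA [in RHS]scalerDr scalerA s2.
  by rewrite scale1r addrC.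
split=> //.
  rewrite {1}/equatorial_proj -scalemxAl mulmxDl mul1mx -scalemxAl EP.
  by rewrite scalerA s2 scale1r half.
rewrite /equatorial_proj expr0 expr1 scale1r scaleN1r -scalerDr addrACA subrr.
by rewrite addr0 half.
Qed.

(* Vectors and operators of the four-fold tensor power of C^2 are given by
   their coordinates in the computational basis, indexed by {ffun 'I_4 -> 'I_2}. *)
Definition tensor4 (R : realType) (M : 'I_4 -> 'M[R[i]]_2)
    (x y : {ffun 'I_4 -> 'I_2}) : R[i] :=
  \prod_(a < 4) M a (x a) (y a).

Definition ghz4 (R : realType) (x : {ffun 'I_4 -> 'I_2}) : R[i] :=
  ((x == [ffun=> 0])%:R + (x == [ffun=> 1])%:R) / (Num.sqrt 2)%:C.

(* Born rule: probability that the players obtain the outputs [o] when player a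
   measures [equatorial (t a)] on its qubit of the GHZ state. *)
Definition ghz_prob (R : realType) (t : 'I_4 -> R)
    (o : {ffun 'I_4 -> bool}) : R :=
  complex.Re (\sum_x \sum_y
    (ghz4 R x)^* * tensor4 (fun a => equatorial_proj (t a) (o a)) x y
    * ghz4 R y).

Definition merp_win (R : realType) (G : xor_game R)
    (theta : forall a : 'I_4, question G a -> R) (c : clause G) : R :=
  \sum_(o : {ffun 'I_4 -> bool} | \big[addb/false]_(a < 4) o a == target c)
    ghz_prob (fun a => theta a (ask c a)) o.

Definition perfect_merp (R : realType) (G : xor_game R)
    (theta : forall a : 'I_4, question G a -> R) : Prop :=
  forall c : clause G, 0 < weight c -> merp_win theta c = 1.

Definition has_perfect_merp (R : realType) (G : xor_game R) : Prop :=
  exists theta : forall a : 'I_4, question G a -> R, perfect_merp theta.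

Definition co_merp_gap (R : realType) (G : xor_game R) : Prop :=
  omega_co G = 1 /\ ~ has_perfect_merp G.

Definition gap_within (R : realType) (n : nat) : Prop :=
  exists G : xor_game R,
    (forall a : 'I_4, (#|active_questions G a| <= n)%N) /\ co_merp_gap G.

(* Main.v *)
(** A strategy whose value is near 1 almost satisfies every clause equation
   prod_a A_(a, q_a) psi = (-1)^b psi. Multiplying such equations and cancelling
   repeated letters player by player gives further equations, the "derived"
   ones, and value one forbids deriving both signs for one tuple. By duality on
   the torus (Smith normal form) a MERP strategy exists iff every integer
   combination n of derived tuples in which, for each player and question, the
   coefficients cancel has even total parity.
   With three questions per player, any nonzero such n admits a move: two or
   three tuples with coefficients of one sign and one or two of the opposite
   sign whose product, in a suitable order, reduces to a single tuple. A move
   makes the l1-norm of n drop and preserves the parity, so n reduces to 0. That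
   moves always exist is a finite statement, verified from a certificate.
   With four questions the eight-clause game asking (i, i, i, i) and
   (i, 1 xor i, 2 xor i, 3 xor i), with one odd target, is won by an explicit
   monomial strategy on (C^4)^{(x) 4}, while the product of all its clause
   equations in phases reads -1 = 1. *)

Require Import Defs.
From HB Require Import structures.
From mathcomp Require Import all_boot all_order all_algebra.
From mathcomp Require Import complex ring lra zify.
From mathcomp Require Import all_classical all_reals all_analysis.

Set Implicit Arguments.
Unset Strict Implicit.
Unset Printing Implicit Defensive.

Import Order.TTheory GRing.Theory Num.Theory.
Import numFieldNormedType.Exports.

Local Open Scope classical_set_scope.
Local Open Scope ring_scope.

(** Value one is only a supremum: no single strategy need satisfy a clause equation exactly. Derived
    equations therefore carry an error constant that is uniform over all strategies, and a
    contradiction appears only as the error tends to 0. The only relation known between observables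
    of one player is that each is an involution, so the order of the factors matters, and one order
    has to serve all four players at once. For three tuples the one of opposite sign goes in the
    middle; for five, each player spoils at most one of six candidate orders, and four is less than
    six. Three labels per player leave 81 tuples but infinitely many n. The search is finite because
    it uses only the signs of n, together with the fact that a balanced n is orthogonal to every
    function additive over the players. What the search excludes are triples with n p > 0, n q > 0,
    n m < 0 and p different from q; once all are gone, balance forces n = 0. *)

(** * Inner products and their norms *)

Section DotTheory.
Variables (C : numClosedFieldType) (U : lmodType C).
Variable form : {dot U for (Num.conj : C -> C)}.

Lemma dot_ge0 u : 0 <= form u u.
Proof. by have [->|u0] := eqVneq u 0; rewrite ?linear0r // ltW // neq0_dnorm_gt0. Qed.

Lemma dotC u v : form v u = (form u v)^*.
Proof. by rewrite [LHS](hermitian_subproof (s := form)) expr0 mul1r. Qed.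

Lemma dot_normZ a u : form (a *: u) (a *: u) = `|a| ^+ 2 * form u u.
Proof. by rewrite linearZl_LR linearZr_LR /= mulrA normCK. Qed.

Lemma dot_normD u v :
  form (u + v) (u + v) = form u u + form v v + (form u v + (form u v)^*).
Proof. by rewrite linearDl /= !linearDr /= (dotC u v); ring. Qed.

Lemma dot_CauchySchwarz u v : `|form u v| ^+ 2 <= form u u * form v v.
Proof.
have [->|v0] := eqVneq v 0.
  by rewrite linear0r normr0 expr0n /= linear0r mulr0.
have vv0 : form v v != 0 by rewrite gt_eqF // neq0_dnorm_gt0.
pose a := form u v / form v v; pose w := u - a *: v.
have wv : form w v = 0.
  by rewrite /w linearBl linearZl_LR /= /a divfK // subrr.
have -> : form u v = a * form v v by rewrite /a divfK.
have uE : u = w + a *: v by rewrite /w subrK.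
have -> : form u u = form w w + `|a| ^+ 2 * form v v.
  have wav : form w (a *: v) = 0 by rewrite linearZr_LR /= wv mulr0.
  by rewrite {1 2}uE dot_normD wav conjC0 !addr0 dot_normZ.
rewrite normrM exprMn [`|form v v|]ger0_norm ?dot_ge0 // [X in _ * X]expr2 mulrA.
by rewrite ler_wpM2r ?dot_ge0 // lerDr dot_ge0.
Qed.

Lemma dot_triangle u v :
  sqrtC (form (u + v) (u + v)) <= sqrtC (form u u) + sqrtC (form v v).
Proof.
have s0 w : 0 <= sqrtC (form w w) by rewrite sqrtC_ge0 dot_ge0.
have s00 : 0 <= sqrtC (form u u) + sqrtC (form v v) by rewrite addr_ge0.
rewrite -[leRHS](sqrCK s00) ler_sqrtC ?nnegrE ?dot_ge0 ?exprn_ge0 //.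
rewrite dot_normD sqrrD !sqrtCK [leRHS]addrAC lerD2l.
have le : `|form u v| <= sqrtC (form u u) * sqrtC (form v v).
  rewrite -(sqrCK (normr_ge0 (form u v))) -sqrtCM ?nnegrE ?dot_ge0 //.
  by rewrite ler_sqrtC ?nnegrE ?mulr_ge0 ?exprn_ge0 ?dot_ge0 // dot_CauchySchwarz.
have re : form u v + (form u v)^* <= `|form u v| *+ 2.
  apply: (le_trans (real_ler_norm _)).
    by rewrite -[X in X + _]conjCK addrC CrealE rmorphD /= conjCK addrC.
  by rewrite (le_trans (ler_normD _ _)) // norm_conjC mulr2n.
by rewrite (le_trans re) // lerMn2r le orbT.
Qed.

End DotTheory.

Local Open Scope complex_scope.

(** * Finite-dimensional Hilbert spaces *)

Definition ell2 (R : realType) (T : finType) := {ffun T -> R[i]}.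

Section Ell2.
Variables (R : realType) (T : finType).
HB.instance Definition _ := GRing.Lmodule.on (ell2 R T).
Definition ell2_dot (f g : ell2 R T) : R[i] := \sum_t f t * Num.conj (g t).

Let dot_addl (v : ell2 R T) : zmod_morphism (ell2_dot ^~ v).
Proof.
move=> f g; rewrite /ell2_dot -sumrB; apply: eq_bigr => t _.
by rewrite !ffunE mulrBl.
Qed.

Let dot_addr (v : ell2 R T) : zmod_morphism (ell2_dot v).
Proof.
move=> f g; rewrite /ell2_dot -sumrB; apply: eq_bigr => t _.
by rewrite !ffunE rmorphB mulrBr.
Qed.

Let dot_scall (v : ell2 R T) : scalable_for *%R (ell2_dot ^~ v).
Proof.
move=> a f; rewrite /ell2_dot mulr_sumr; apply: eq_bigr => t _.
by rewrite !ffunE /GRing.scale /= mulrA.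
Qed.

Let dot_scalr (v : ell2 R T) : scalable_for (Num.conj \; *%R) (ell2_dot v).
Proof.
move=> a f; rewrite /ell2_dot /= mulr_sumr; apply: eq_bigr => t _.
by rewrite !ffunE /GRing.scale /= rmorphM mulrCA.
Qed.

HB.instance Definition _ := isBilinear.Build R[i] (ell2 R T) (ell2 R T) R[i]
  *%R (Num.conj \; *%R) ell2_dot dot_addl dot_addr dot_scall dot_scalr.

Let dot_herm (f g : ell2 R T) :
  ell2_dot f g = (-1) ^+ false * Num.conj (ell2_dot g f).
Proof.
rewrite expr0 mul1r /ell2_dot rmorph_sum; apply: eq_bigr => t _ /=.
by rewrite rmorphM /= conjCK mulrC.
Qed.

HB.instance Definition _ := isHermitianSesquilinear.Build R[i] (ell2 R T) false
  Num.conj ell2_dot dot_herm.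

Lemma ell2_dotE (f : ell2 R T) : ell2_dot f f = \sum_t `|f t| ^+ 2.
Proof. by apply: eq_bigr => t _; rewrite normCK. Qed.

Let dot_pos (f : ell2 R T) : f != 0 -> 0 < ell2_dot f f.
Proof.
move=> f0; have /existsP[t ft] : [exists t, f t != 0].
  apply: contraNT f0 => /existsPn f0; apply/eqP/ffunP => t.
  by rewrite ffunE; apply/eqP; rewrite -[_ == _]negbK.
rewrite ell2_dotE (bigD1 t) //= ltr_pwDl ?exprn_gt0 ?normr_gt0 //.
by rewrite sumr_ge0 // => s _; rewrite exprn_ge0.
Qed.

HB.instance Definition _ := isDotProduct.Build R[i] (ell2 R T) ell2_dot dot_pos.

Let norm (f : ell2 R T) : R[i] := sqrtC (ell2_dot f f).

Let normD f g : norm (f + g) <= norm f + norm g.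
Proof. exact: dot_triangle. Qed.

Let normZ a f : norm (a *: f) = `|a| * norm f.
Proof.
rewrite /norm dot_normZ sqrtCM ?nnegrE ?exprn_ge0 ?dot_ge0 //.
by rewrite sqrCK.
Qed.

Let norm_eq0 f : norm f = 0 -> f = 0.
Proof.
move/eqP; rewrite sqrtC_eq0; apply: contraTeq => f0.
by rewrite gt_eqF // dot_pos.
Qed.

HB.instance Definition _ := Lmodule_isNormed.Build R[i] (ell2 R T)
  normD normZ norm_eq0.

Lemma ell2_normE (f : ell2 R T) : `|f| = sqrtC (ell2_dot f f).
Proof. by []. Qed.

Lemma ell2_norm_ge (f : ell2 R T) t : `|f t| <= `|f|.
Proof.
have le : `|f t| ^+ 2 <= ell2_dot f f.
  by rewrite ell2_dotE (bigD1 t) //= lerDl sumr_ge0.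
by rewrite ell2_normE -[leLHS](sqrCK (normr_ge0 _)) ler_sqrtC ?nnegrE ?dot_ge0.
Qed.

Lemma ell2_norm_le (f : ell2 R T) : `|f| <= \sum_t `|f t|.
Proof.
have s0 : 0 <= \sum_t `|f t| by rewrite sumr_ge0.
rewrite ell2_normE -(sqrCK s0) ler_sqrtC ?nnegrE ?exprn_ge0 ?dot_ge0 //.
rewrite ell2_dotE expr2 mulr_suml ler_sum // => t _.
by rewrite expr2 ler_wpM2l // (bigD1 t) //= lerDl sumr_ge0.
Qed.

Let normc_ge_Im (z : R[i]) : `|complex.Im z|%:C <= `|z|.
Proof.
rewrite normc_def lecR -sqrtr_sqr ler_wsqrtr // lerDr sqr_ge0 //.
Qed.

Let normc_le_ReIm (z : R[i]) :
  `|z| <= (`|complex.Re z| + `|complex.Im z|)%:C.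
Proof.
rewrite normc_def lecR -[leRHS]ger0_norm ?addr_ge0 // -sqrtr_sqr ler_wsqrtr //.
by rewrite sqrrD !real_normK ?num_real // addrAC -addrA lerD2l lerDl.
Qed.

(** Real and imaginary parts of every coordinate are Cauchy in [R], and the finitely many
    coordinates control the norm. *)
Let complete (F : set_system (ell2 R T)) : ProperFilter F -> cauchy F -> cvg F.
Proof.
move=> FF /cauchy_ballP Fc.
have part (p : R[i] -> R) t : (forall z, `|p z|%:C <= `|z|) ->
    {morph p : x y / x - y} ->
    exists l : R, (fun f : ell2 R T => p (f t)) @ F --> l.
  move=> pn pB; apply/cvg_ex/cauchy_cvgP/cauchy_ballP => e e0.
  have := Fc e%:C; rewrite ltcR => /(_ e0) Fe.
  rewrite near_map2; apply: filterS Fe => -[f g] /=.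
  rewrite -!ball_normE /= => fg.
  rewrite -ltcR (le_lt_trans _ fg) // -pB (le_trans (pn _)) //.
  by have := ell2_norm_ge (f - g) t; rewrite !ffunE.
have ReP t : exists l : R, (fun f : ell2 R T => complex.Re (f t)) @ F --> l.
  by apply: part => [z|[? ?] [? ?]//]; exact: normc_ge_Re.
have ImP t : exists l : R, (fun f : ell2 R T => complex.Im (f t)) @ F --> l.
  by apply: part => [z|[? ?] [? ?]//]; exact: normc_ge_Im.
have [a aP] := choice ReP.
have [b bP] := choice ImP.
apply/cvg_ex; exists ([ffun t => a t +i* b t] : ell2 R T).
apply/cvgrPdist_le => e e0.
(* Norms take values in [R[i]], so [e] is a positive complex number, hence real. The factor 2 pays
   for the two parts of a coordinate; the successor keeps the denominator nonzero when [T] is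
   empty. *)
pose d : R := complex.Re e / (2 * #|T|.+1%:R).
have eE : e = (complex.Re e)%:C by rewrite RRe_real // gtr0_real.
have d0 : 0 < d.
  by rewrite divr_gt0 ?mulr_gt0 // -ltcR -eE.
have : F [set f : ell2 R T | forall t : T,
    `|a t - complex.Re (f t)| <= d /\ `|b t - complex.Im (f t)| <= d].
  apply: filter_forall => t.
  have /cvgrPdist_le/(_ _ d0) h1 := aP t.
  have /cvgrPdist_le/(_ _ d0) h2 := bP t.
  by apply: filterS2 h1 h2.
apply: filterS => f fd; apply: (le_trans (ell2_norm_le _)).
have le t : `|([ffun t => a t +i* b t] - f : ell2 R T) t| <= (2 * d)%:C.
  rewrite (le_trans (normc_le_ReIm _)) // lecR !ffunE mulr_natl mulr2n lerD //.
    by have [] := fd t; case: (f t).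
  by have [] := fd t; case: (f t).
apply: (le_trans (ler_sum _ (fun t _ => le t))).
rewrite sumr_const eE -rmorphMn lecR -[_ *+ _]mulr_natl /d.
rewrite (_ : 2 * _ = complex.Re e / #|T|.+1%:R); last first.
  by rewrite invfM mulrCA mulVKf ?pnatr_eq0.
rewrite mulrCA ger_pMr; last by rewrite -ltcR -eE.
by rewrite ler_pdivrMr // mul1r ler_nat.
Qed.

HB.instance Definition _ := Uniform_isComplete.Build (ell2 R T) complete.

Definition ell2_space : hilbertSpace R.
Proof.
refine (@HilbertSpace R (ell2 R T) ell2_dot _) => f.
by rewrite ell2_normE sqrtCK.
Defined.
End Ell2.

(** * Strategies with monomial observables on a tensor power *)

Section LocalStrategy.
Variables (R : realType) (Q : 'I_4 -> finType) (D : finType).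
Variables (sig : forall a, Q a -> D -> D) (ph : forall a, Q a -> D -> R[i]).
(** These make the matrix with entry [ph j d] in row [d] and column [sig j d] a self-adjoint
    involution: [sigK] and [phM] give the square, [phC] the adjoint. *)
Hypothesis sigK : forall a j, involutive (@sig a j).
Hypothesis phM : forall a j d, @ph a j d * ph j (sig j d) = 1.
Hypothesis phC : forall a j d, Num.conj (@ph a j d) = ph j (sig j d).

Notation V := (ell2_space R {ffun 'I_4 -> D}).

Definition upd (a : 'I_4) (f : D -> D) (t : {ffun 'I_4 -> D}) : {ffun 'I_4 -> D} :=
  [ffun b => if b == a then f (t b) else t b].

(* Observables act monomially: |t> is sent to a phase times |sig j t>. *)
Definition loc_fun a (j : Q a) (f : V) : V :=
  [ffun t : {ffun 'I_4 -> D} => ph j (t a) * (f : {ffun _ -> _}) (upd a (sig j) t)].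

Fact loc_fun_linear a j : linear (@loc_fun a j).
Proof.
move=> k f g; apply/ffunP => t; rewrite !ffunE /GRing.scale /= mulrDr.
by congr (_ + _); rewrite mulrCA.
Qed.

HB.instance Definition _ a j := GRing.isLinear.Build R[i] V V _ (@loc_fun a j)
  (@loc_fun_linear a j).

Lemma upd_invol a j : involutive (upd a (@sig a j)).
Proof. by move=> t; apply/ffunP => b; rewrite !ffunE; case: eqP => // _; rewrite sigK. Qed.

Lemma loc_fun_sa a j : @self_adjoint R V (@loc_fun a j).
Proof.
move=> f g; rewrite /= /ell2_dot [RHS](reindex_inj (inv_inj (upd_invol j))).
apply: eq_bigr => t _; rewrite /= !ffunE upd_invol eqxx rmorphM /= phC sigK.
by rewrite mulrCA mulrA [X in X * _]mulrC.
Qed.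

Lemma loc_fun_invol a j (f : V) : loc_fun j (@loc_fun a j f) = f.
Proof.
apply/ffunP => t; rewrite !ffunE eqxx upd_invol mulrA phM.
by rewrite mul1r.
Qed.

Lemma loc_fun_comm a b (j : Q a) (k : Q b) : a != b -> forall f : V,
  loc_fun j (loc_fun k f) = loc_fun k (loc_fun j f).
Proof.
move=> ab f; apply/ffunP => t; rewrite !ffunE [b == a]eq_sym (negbTE ab) mulrCA.
congr (_ * (_ * f _)); apply/ffunP => c; rewrite !ffunE.
case: (c =P a) => // ca; case: (c =P b) => // cb.
by rewrite -ca -cb eqxx in ab.
Qed.

Lemma loc_fun_bounded a j : @bounded_op R V (@loc_fun a j).
Proof.
exists 1 => f; rewrite mul1r -[leLHS]sqrCK // -[leRHS]sqrCK //.
by rewrite -!hdotE (loc_fun_sa j f (loc_fun j f)) /= loc_fun_invol.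
Qed.

Definition local_strategy (psi : V) (psi1 : `|psi| = 1) : co_strategy R Q :=
  @CoStrategy R Q V psi (fun a j => @loc_fun a j) psi1 loc_fun_bounded
    loc_fun_sa loc_fun_invol loc_fun_comm.

End LocalStrategy.

Lemma ord4_ind (P : 'I_4 -> Prop) : P ord0 -> P (lift ord0 ord0) ->
  P (lift ord0 (lift ord0 ord0)) -> P (lift ord0 (lift ord0 (lift ord0 ord0))) ->
  forall a, P a.
Proof.
move=> P0 P1 P2 P3 [[|[|[|[|//]]]] p].
- by rewrite (_ : Ordinal p = ord0) //; apply: val_inj.
- by rewrite (_ : Ordinal p = lift ord0 ord0) //; apply: val_inj.
- by rewrite (_ : Ordinal p = lift ord0 (lift ord0 ord0)) //; apply: val_inj.
- by rewrite (_ : Ordinal p = lift ord0 (lift ord0 (lift ord0 ord0))) //; apply: val_inj.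
Qed.

Lemma local_clause_op (R : realType) (G : xor_game R) (D : finType)
    (sig : forall a, question G a -> D -> D)
    (ph : forall a, question G a -> D -> R[i])
    sigK phM phC psi psi1 (c : clause G) (f : ell2_space R {ffun 'I_4 -> D}) t :
  (clause_op (@local_strategy R _ D sig ph sigK phM phC psi psi1) c f : {ffun _ -> _}) t =
  (\prod_a ph a (ask c a) (t a)) *
  (f : {ffun _ -> _}) [ffun a => sig a (ask c a) (t a)].
Proof.
rewrite /clause_op !big_ord_recl !big_ord0 /= !ffunE /= mulr1 -!mulrA.
congr (_ * (_ * (_ * (_ * _)))); congr (f _); apply/ffunP => a; rewrite !ffunE.
by move: a; apply: ord4_ind.
Qed.

Lemma obs_isometry (R : realType) (Q : 'I_4 -> finType) (S : co_strategy R Q) a j (x y : Defs.space S) :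
  hdot (Defs.space S) (@obs _ _ S a j x) (obs S j y) = hdot (Defs.space S) x y.
Proof. by rewrite obs_sa obs_invol. Qed.

Lemma obs_norm (R : realType) (Q : 'I_4 -> finType) (S : co_strategy R Q) a j (x : Defs.space S) : `|@obs _ _ S a j x| = `|x|.
Proof.
by rewrite -[LHS]sqrCK // -[RHS]sqrCK // -!hdotE obs_isometry.
Qed.

(** * Value of a strategy and approximate clause equations *)

Section Success.
Variables (R : realType) (G : xor_game R).
Implicit Types S : co_strategy R (question G).

Lemma clause_op_norm S c (x : Defs.space S) : `|clause_op S c x| = `|x|.
Proof. by rewrite /clause_op !big_ord_recl big_ord0 /= !obs_norm. Qed.

(** Expansion of the square, with the clause operator an isometry and the correlator real. This is
    the bridge between the value of a strategy and equations between vectors. *)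
Lemma clause_op_dist S (c : clause G) (b : bool) :
  `|clause_op S c (state S) - (-1) ^+ b *: state S| ^+ 2 =
  (2 * (1 - (-1) ^+ b * complex.Re (clause_corr S c)))%:C.
Proof.
set s : R[i] := (-1) ^+ b.
have sC : Num.conj s = s by rewrite /s rmorph_sign.
have s2 : s * s = 1 by rewrite /s -expr2 sqrr_sign.
pose r := complex.Re (clause_corr S c).
have corrE : hdot (Defs.space S) (state S) (clause_op S c (state S)) = r%:C.
  by rewrite -[LHS]/(clause_corr S c) clause_corr_real.
have corrE' : hdot (Defs.space S) (clause_op S c (state S)) (state S) = r%:C.
  by rewrite dotC corrE; apply/eqP; rewrite eq_complex /= oppr0 !eqxx.
rewrite -hdotE dot_normD !hdotE normrN normrZ clause_op_norm state_unit.
rewrite normr_sign mul1r expr1n linearNr /= linearZr_LR /= corrE'.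
have -> : s = ((-1) ^+ b)%:C by rewrite rmorph_sign.
by apply/eqP; rewrite eq_complex /=; apply/andP; split; apply/eqP; ring.
Qed.

Lemma clause_corr_le S (c : clause G) (b : bool) :
  (-1) ^+ b * complex.Re (clause_corr S c) <= 1.
Proof.
rewrite -subr_ge0 -(pmulr_rge0 _ (ltr0n R 2)) -ler0c -clause_op_dist.
by rewrite exprn_ge0.
Qed.

Lemma success_gap S :
  1 - success S =
  \sum_c weight c / 2 * (1 - (-1) ^+ target c * complex.Re (clause_corr S c)).
Proof.
rewrite -{1}(weight_sum1 G) /success -sumrB; apply: eq_bigr => c _.
set x := _ * complex.Re _; set p := weight c.
have p2 : p = p / 2 + p / 2 by rewrite -splitr.
by rewrite {1}p2 mulrDr mulrBr mulr1 opprD addrACA subrr add0r.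
Qed.

Lemma success_le1 S : success S <= 1.
Proof.
rewrite -subr_ge0 success_gap sumr_ge0 // => c _.
by rewrite mulr_ge0 ?divr_ge0 ?weight_ge0 // subr_ge0 clause_corr_le.
Qed.

Lemma success_perfect S :
  (forall c, 0 < weight c ->
    clause_op S c (state S) = (-1) ^+ target c *: state S) -> success S = 1.
Proof.
move=> win; apply/eqP; rewrite eq_sym -subr_eq0 success_gap; apply/eqP.
apply: big1 => c _; have [w0|w0] := eqVneq (weight c) 0; first by rewrite w0 !mul0r.
have wc : 0 < weight c by rewrite lt_def w0 weight_ge0.
have := clause_op_dist S c (target c).
rewrite win // subrr normr0 expr0n /= => /esym/eqP; rewrite eq_complex /=.
rewrite mulf_eq0 pnatr_eq0 /= => /andP[/eqP -> _]; exact: mulr0.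
Qed.

Lemma omega_co_attained S : success S = 1 -> omega_co G = 1.
Proof.
move=> S1; apply/eqP; rewrite eq_le; apply/andP; split.
  apply: ge_sup; first by exists 1, S.
  by move=> _ [S' ->]; exact: success_le1.
by apply: ub_le_sup; [exists 1 => _ [S' ->]; exact: success_le1 | exists S].
Qed.

Lemma omega_co_near (e : R) : omega_co G = 1 -> 0 < e ->
  exists S, 1 - e < success S.
Proof.
move=> w1 e0; pose A := [set v | exists S : co_strategy R (question G), v = success S].
have hA : has_sup A.
  split; last by exists 1 => _ [S' ->]; exact: success_le1.
  (* [sup] of the empty set is 0, so the value 1 itself shows that strategies exist. *)
  apply/set0P/eqP => A0; have := w1; rewrite /omega_co -/A A0 sup0 => /eqP.
  by rewrite eq_sym oner_eq0.
have [_ [S ->]] := sup_adherent e0 hA.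
by rewrite -/(omega_co G) w1; exists S.
Qed.

End Success.

Section PhaseState.
Variables (R : realType) (T : finType) (A : {set T}) (u : T -> R[i]).
Hypotheses (A0 : A != finset.set0) (u1 : forall t, `|u t| = 1).

Definition phase_state : ell2_space R T :=
  [ffun t => (t \in A)%:R * u t / sqrtC #|A|%:R].

Lemma phase_state_unit : `|phase_state| = 1.
Proof.
rewrite ell2_normE ell2_dotE.
have cA : #|A|%:R != 0 :> R[i] by rewrite pnatr_eq0 cards_eq0.
rewrite (_ : \sum_t _ = \sum_(t in A) #|A|%:R^-1).
  by rewrite sumr_const -[_ *+ _]mulr_natl mulfV // sqrtC1.
rewrite [RHS]big_mkcond; apply: eq_bigr => t _; rewrite ffunE.
case: (t \in A); last by rewrite !mul0r normr0 expr0n.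
rewrite mul1r normrM u1 mul1r normfV exprVn.
by rewrite -normrX sqrtCK ger0_norm.
Qed.

End PhaseState.

(** Reduces value one to a finite check on basis vectors; the state is the superposition of [A] with
    phases [u] and equal moduli. Both constructions of perfect strategies go through it. *)
Lemma local_perfect (R : realType) (G : xor_game R) (D : finType)
    (sig : forall a, question G a -> D -> D)
    (ph : forall a, question G a -> D -> R[i])
    (A : {set {ffun 'I_4 -> D}}) (u : {ffun 'I_4 -> D} -> R[i]) :
  (forall a j, involutive (@sig a j)) ->
  (forall a j d, `|@ph a j d| = 1) ->
  (forall a j d, @ph a j d * ph a j (sig a j d) = 1) ->
  A != finset.set0 -> (forall t, `|u t| = 1) ->
  (forall c, 0 < weight c -> forall t, t \in A ->
     let t' := [ffun a => sig a (ask c a) (t a)] in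
     t' \in A /\
     (\prod_a ph a (ask c a) (t a)) * u t' = (-1) ^+ target c * u t) ->
  omega_co G = 1.
Proof.
move=> sigK ph1 phM A0 u1 win.
have phC a j d : Num.conj (@ph a j d) = ph a j (sig a j d).
  have p0 : ph a j d != 0 by rewrite -normr_eq0 ph1 oner_neq0.
  by apply: (mulfI p0); rewrite phM -normCK ph1 expr1n.
pose S := local_strategy sigK phM phC (phase_state_unit A0 u1).
apply: (@omega_co_attained _ _ S); apply: success_perfect => c wc.
apply/ffunP => t; rewrite local_clause_op /= !ffunE.
set t' := [ffun a => _].
have t't : [ffun a => sig a (ask c a) (t' a)] = t.
  by apply/ffunP => a; rewrite !ffunE sigK.
(* The clause acts on basis vectors by an involution that preserves [A], hence also its complement,
   where both sides vanish. *)
have t'A : (t' \in A) = (t \in A).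
  apply/idP/idP => [h|h]; last by have [] := win c wc t h.
  by have := win c wc t' h; rewrite /= t't => -[].
rewrite t'A; case: (boolP (t \in A)) => [tA|_]; last by rewrite !mul0r mulr0 /GRing.scale /= mulr0.
by rewrite !mul1r mulrA; have [_ ->] := win c wc t tA; rewrite -mulrA.
Qed.

(** * Phases, and winning probabilities of MERP strategies *)

Section Cis.
Variable R : realType.
Implicit Types x y : R.

Definition cis x : R[i] := cos x +i* sin x.

Lemma cisD x y : cis (x + y) = cis x * cis y.
Proof. by rewrite /cis cosD sinD; apply/eqP; rewrite eq_complex /= eqxx /=; apply/eqP; ring. Qed.

Lemma cis0 : cis 0 = 1. Proof. by rewrite /cis cos0 sin0. Qed.

Lemma norm_cis x : `|cis x| = 1.
Proof. by rewrite normc_def /= cos2Dsin2 sqrtr1. Qed.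

Lemma cis_neq0 x : cis x != 0.
Proof. by rewrite -normr_eq0 norm_cis oner_neq0. Qed.

Lemma cisN x : cis (- x) = (cis x)^-1.
Proof.
apply: (mulfI (cis_neq0 x)); rewrite -cisD subrr cis0.
by rewrite mulfV //; exact: cis_neq0.
Qed.

Lemma cis_sum (I : Type) (r : seq I) (P : pred I) (f : I -> R) :
  cis (\sum_(i <- r | P i) f i) = \prod_(i <- r | P i) cis (f i).
Proof. by apply: (big_morph cis cisD cis0). Qed.

Lemma cis_sign x (b : bool) : (-1) ^+ b * cos x = 1 -> cis x = (-1) ^+ b.
Proof.
move=> h; have cx : cos x = (-1) ^+ b.
  by case: b h; rewrite ?expr0 ?expr1; lra.
have sx : sin x = 0.
  have := cos2Dsin2 x; rewrite cx sqrr_sign => /eqP.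
  by rewrite -subr_eq0 addrAC subrr add0r sqrf_eq0 => /eqP.
by rewrite /cis sx cx -[X in _ = X](rmorph_sign (real_complex R)).
Qed.
End Cis.

Section MerpWin.
Variable R : realType.

Lemma ghz4_sum (F : {ffun 'I_4 -> 'I_2} -> R[i]) :
  \sum_x ghz4 R x * F x = (F [ffun=> 0] + F [ffun=> 1]) / (Num.sqrt 2)%:C.
Proof.
rewrite (eq_bigr (fun x => (x == [ffun=> 0])%:R * F x / (Num.sqrt 2)%:C +
                           (x == [ffun=> 1])%:R * F x / (Num.sqrt 2)%:C)); last first.
  by move=> x _; rewrite /ghz4; ring.
rewrite big_split /= -!mulr_suml -mulrDl; congr ((_ + _) / _).
  rewrite (bigD1 [ffun=> 0]) //= eqxx mul1r big1 ?addr0 // => x /negbTE ->.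
  by rewrite mul0r.
rewrite (bigD1 [ffun=> 1]) //= eqxx mul1r big1 ?addr0 // => x /negbTE ->.
by rewrite mul0r.
Qed.

Lemma equatorial_projE (t : R) b (i j : 'I_2) : equatorial_proj t b i j =
  2^-1 * (if i == j then 1 else (-1) ^+ b * cis (if i == 0 then - t else t)).
Proof.
rewrite /equatorial_proj /equatorial /pauliX /pauliY !mxE.
congr (_ * _); case: (i =P j) => [_|ij]; first by rewrite !mulr0 addr0 mulr0 addr0.
rewrite add0r mulr1 /cis; congr (_ * _); apply/eqP; rewrite eq_complex.
by case: (i =P 0) => _ /=; rewrite ?cosN ?sinN; apply/andP; split; apply/eqP; ring.
Qed.

Lemma sign_addb (o : {ffun 'I_4 -> bool}) :
  \prod_a (-1) ^+ o a = (-1) ^+ (\big[addb/false]_a o a) :> R[i].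
Proof.
apply/esym; apply: (big_morph (fun b : bool => (-1) ^+ b : R[i])) => // x y.
by rewrite signr_addb.
Qed.

(** Only the four matrix entries between the all-0 and all-1 vectors contribute. The two diagonal
    ones are 1/16; the other two carry the product of the output signs and the phases exp (-i S) and
    exp (i S), where S is the sum of the angles. *)
Lemma ghz_probE (t : 'I_4 -> R) (o : {ffun 'I_4 -> bool}) :
  ghz_prob t o = (1 + (-1) ^+ (\big[addb/false]_a o a) * cos (\sum_a t a)) / 16.
Proof.
pose F x y := tensor4 (fun a => equatorial_proj (t a) (o a)) x y.
pose h : R[i] := (Num.sqrt 2)%:C.
have h2 : h * h = 2 by rewrite /h -rmorphM -expr2 sqr_sqrtr // rmorph_nat.
have conj_ghz x : Num.conj (ghz4 R x) = ghz4 R x.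
  have hC : Num.conj h = h by apply/eqP; rewrite eq_complex /= oppr0 !eqxx.
  by rewrite /ghz4 rmorphM rmorphD !rmorph_nat fmorphV -/h /= hC.
have Fd b : F [ffun=> b] [ffun=> b] = 16^-1.
  rewrite /F /tensor4 (eq_bigr (fun=> 2^-1)) => [|a _].
    by rewrite prodr_const card_ord exprVn -natrX.
  by rewrite equatorial_projE !ffunE eqxx mulr1.
have Fo (b c : 'I_2) : b != c -> F [ffun=> b] [ffun=> c] =
   16^-1 * ((-1) ^+ (\big[addb/false]_a o a) * cis (if b == 0 then - \sum_a t a else \sum_a t a)).
  move=> /negbTE bc; rewrite /F /tensor4.
  rewrite (eq_bigr (fun a => 2^-1 *
    ((-1) ^+ o a * cis (if b == 0 then - t a else t a)))); last first.
    by move=> a _; rewrite equatorial_projE !ffunE bc.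
  rewrite big_split prodr_const card_ord exprVn -natrX; congr (_ * _).
  rewrite big_split /= sign_addb; congr (_ * _).
  case: (b == 0); last by rewrite cis_sum.
  by rewrite -sumrN cis_sum.
rewrite /ghz_prob (eq_bigr (fun x => ghz4 R x * (\sum_y ghz4 R y * F x y))); last first.
  move=> x _; rewrite mulr_sumr; apply: eq_bigr => y _.
  by rewrite -[X in X * _ * _]/(Num.conj (ghz4 R x)) conj_ghz /F; ring.
rewrite ghz4_sum !ghz4_sum !Fd !Fo //.
rewrite -/h /=; set b := \big[addb/false]_a o a; set S := \sum_a t a.
have cc : cis (- S) + cis S = 2 * (cos S)%:C.
  by apply/eqP; rewrite eq_complex /= cosN sinN; apply/andP; split; apply/eqP; ring.
rewrite [X in complex.Re X](_ : _ = ((1 + (-1) ^+ b * cos S) / 16)%:C) //.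
transitivity (16^-1 * (2 + (-1) ^+ b * (cis (- S) + cis S)) * (h * h)^-1).
  by rewrite invfM; ring.
rewrite cc h2 rmorphM rmorphD rmorphM rmorph_sign rmorph1 fmorphV rmorph_nat.
rewrite [RHS]mulrC -mulrA; congr (_ * _).
rewrite (_ : 2 + _ = 2 * (1 + (-1) ^+ b * (cos S)%:C)); last by ring.
by rewrite mulrAC mulfV ?pnatr_eq0 // mul1r.
Qed.

(** Eight of the sixteen output strings have parity [b]: the indicator is averaged over the parity
    character, whose total sum factors over the players and vanishes. *)
Lemma parity_count (s : R) (b : bool) :
  \sum_(o : {ffun 'I_4 -> bool} | \big[addb/false]_a o a == b)
    (1 + (-1) ^+ (\big[addb/false]_a o a) * s) = 8 * (1 + (-1) ^+ b * s).
Proof.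
rewrite (eq_bigr (fun=> 1 + (-1) ^+ b * s)) => [|o /eqP -> //].
rewrite sumr_const -[LHS]mulr_natl; congr (_ * _).
have -> : #|[pred o : {ffun 'I_4 -> bool} | \big[addb/false]_a o a == b]|%:R =
    \sum_(o : {ffun 'I_4 -> bool}) (1 + (-1) ^+ b * \prod_a (-1) ^+ o a) / 2 :> R.
  rewrite -sum1_card natr_sum big_mkcond; apply: eq_bigr => o _.
  rewrite (_ : \prod_a _ = (-1) ^+ (\big[addb/false]_a o a)); last first.
    by apply/esym; apply: (big_morph (fun b : bool => (-1) ^+ b : R)) => // x y; rewrite signr_addb.
  rewrite -signr_addb inE.
  by case: b; case: (\big[addb/false]_a o a) => /=; rewrite ?expr0 ?expr1; lra.
rewrite -mulr_suml big_split /= sumr_const card_ffun card_bool card_ord.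
rewrite -mulr_sumr -(bigA_distr_bigA (fun _ (x : bool) => (-1) ^+ x)) /=.
rewrite big_ord_recl big_bool /= expr0 expr1 addNr mul0r mulr0 addr0.
by rewrite -[_ *+ _]/(16%:R); lra.
Qed.

Lemma merp_winE (G : xor_game R) (theta : forall a, question G a -> R) c :
  merp_win theta c =
  (1 + (-1) ^+ target c * cos (\sum_a theta a (ask c a))) / 2.
Proof.
rewrite /merp_win.
under eq_bigr => o _ do rewrite ghz_probE.
by rewrite -mulr_suml parity_count; field.
Qed.

Lemma merp_win1 (G : xor_game R) (theta : forall a, question G a -> R) c :
  merp_win theta c = 1 <-> cis (\sum_a theta a (ask c a)) = (-1) ^+ target c.
Proof.
rewrite merp_winE; set S := \sum_a _; split=> [h|/(congr1 (@complex.Re R)) /= cS].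
  by apply: cis_sign; lra.
have -> : cos S = (-1) ^+ target c.
  by rewrite cS; case: (target c); rewrite ?expr0 ?expr1.
by rewrite -expr2 sqrr_sign; lra.
Qed.

End MerpWin.

(** An equatorial observable flips the bit, and [ph] lists its nonzero entries by row. The GHZ state
    is the uniform superposition of the two constant strings, which every clause exchanges. *)
Lemma merp_omega_co (R : realType) (G : xor_game R) :
  has_perfect_merp G -> omega_co G = 1.
Proof.
case=> theta win.
pose ph a (j : question G a) (d : bool) := cis (if d then theta a j else - theta a j).
pose A : {set {ffun 'I_4 -> bool}} := [set t | t \in [:: [ffun=> false]; [ffun=> true]]]%SET.
apply: (@local_perfect _ G bool (fun _ _ => negb) ph A (fun=> 1)).
- by move=> a j; exact: negbK.
- by move=> a j d; exact: norm_cis.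
- by move=> a j [] /=; rewrite /ph -cisD ?addNr ?subrr cis0.
- by apply/set0Pn; exists [ffun=> false]; rewrite inE mem_head.
- by move=> t; exact: normr1.
move=> c wc t; rewrite !inE => tA t'; rewrite !mulr1.
have /merp_win1 cS := win c wc.
have t'A : (t' == [ffun=> false]) || (t' == [ffun=> true]).
  by rewrite /t'; case/orP: tA => /eqP ->; apply/orP; [right|left];
    apply/eqP/ffunP => a; rewrite !ffunE.
split; first by rewrite !inE.
case/orP: tA => /eqP ->; last first.
  by rewrite -cS cis_sum; apply: eq_bigr => a _; rewrite ffunE.
rewrite -[RHS](invrK) -exprVn invrN1 -cS.
rewrite cis_sum -prodfV; apply: eq_bigr => a _; by rewrite ffunE /ph cisN.
Qed.

(** * The separating game with four questions per player *)

Definition xor4 (i a : nat) : nat :=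
  nth 0%N (nth [::] [:: [:: 0; 1; 2; 3]; [:: 1; 0; 3; 2]; [:: 2; 3; 0; 1]; [:: 3; 2; 1; 0]] i)%N a.

(** Players and questions are natural numbers here so that the finite checks below evaluate;
    ordinals enter only in [gap_game]. *)
Definition gap_ask (c : bool * nat) (a : nat) : nat := if c.1 then xor4 c.2 a else c.2.

Lemma eighth_sum (R : realType) : \sum_(c : bool * 'I_4) (8^-1 : R) = 1.
Proof. by rewrite sumr_const card_prod card_bool card_ord -[LHS]mulr_natr mulVf // pnatr_eq0. Qed.

Definition gap_game (R : realType) : xor_game R :=
  @XorGame R (fun=> 'I_4 : finType) (bool * 'I_4)%type
    (fun c a => inord (gap_ask (c.1, nat_of_ord c.2) a)) (fun=> 8^-1) (pred1 (false, inord 1))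
    (fun=> ltac:(by rewrite invr_ge0)) (eighth_sum R).

Lemma gap_game_active (R : realType) a : #|active_questions (gap_game R) a| = 4%N.
Proof.
rewrite -[RHS](card_ord 4) -cardsT; congr #|pred_of_set _|; apply/setP => j.
rewrite !inE; apply/existsP; exists (false, j).
by rewrite /= invr_gt0 ltr0n /= /gap_ask inord_val eqxx.
Qed.

(** For each player a, the map i |-> a xor i permutes the questions. Either family of four clauses
    thus uses every phase [z a k] once, and the two products agree although exactly one target is
    odd. *)
Lemma gap_game_no_merp (R : realType) : ~ has_perfect_merp (gap_game R).
Proof.
case=> theta win; pose z a k := cis (theta a (inord k)).
have {}win (b : bool) (i : 'I_4) :
    \prod_a z a (gap_ask (b, nat_of_ord i) a) = (-1) ^+ ((b, i) == (false, inord 1)).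
  have /merp_win1 : merp_win theta ((b, i) : clause (gap_game R)) = 1.
    by apply: win; rewrite /= invr_gt0 ltr0n.
  by rewrite cis_sum.
have same : \prod_(i < 4) \prod_a z a (gap_ask (false, nat_of_ord i) a) =
    \prod_(i < 4) \prod_a z a (gap_ask (true, nat_of_ord i) a).
  by rewrite !big_ord_recl !big_ord0 /gap_ask /xor4 /bump /=; ring.
have : (\prod_(i < 4) (-1) ^+ ((false, i) == (false, inord 1)) : R[i]) = 1.
  under eq_bigr => i _ do rewrite -win.
  by rewrite same; under eq_bigr => i _ do rewrite win /=; rewrite big1_eq.
rewrite (bigD1 (inord 1)) //= eqxx big1 => [|i /negPf ni]; last by rewrite xpair_eqE eqxx ni.
by rewrite mulr1 expr1 => /eqP; rewrite eq_sym -subr_eq0 opprK -[1 + 1]/(2%:R) pnatr_eq0.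
Qed.

(* With w = exp (i pi / 4), question q acts on basis vectors indexed by t in Z/4
   through t |-> flip q t with phase w ^ kick q t, and the shared state is the
   sum of w ^ phase_exp t |t> over [support]; found by computer search. *)
Definition flip (q t : nat) : nat := ((nth 0 [:: 0; 1; 0; 3] q + 4 - t) %% 4)%N.

Definition kick (q t : nat) : nat := nth 0%N [:: 0; 0; 2 * t; 7 + 6 * t]%N q.

Definition support (t0 t1 t2 t3 : nat) : bool :=
  (t0 + t2 == t1 + t3 %[mod 4])%N && ~~ odd (t0 + t2).

Definition phase_exp (t0 t1 t2 : nat) : nat :=
  let p := odd (t0 + t1) in
  (p + 4 * (odd t0 + t1./2 + t2./2 + (t0./2 + t1./2) * p))%N.

Definition turns_ok (b : bool) (i t0 t1 t2 t3 : nat) : bool :=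
  (let q := gap_ask (b, i) in
  support t0 t1 t2 t3 ==>
  support (flip (q 0) t0) (flip (q 1) t1) (flip (q 2) t2) (flip (q 3) t3) &&
  (kick (q 0) t0 + kick (q 1) t1 + kick (q 2) t2 + kick (q 3) t3
    + phase_exp (flip (q 0) t0) (flip (q 1) t1) (flip (q 2) t2)
  == 4 * (~~ b && (i == 1)) + phase_exp t0 t1 t2 %[mod 8]))%N.

Lemma turns_okP b i t0 t1 t2 t3 : (i < 4)%N -> (t0 < 4)%N -> (t1 < 4)%N -> (t2 < 4)%N ->
  (t3 < 4)%N -> turns_ok b i t0 t1 t2 t3.
Proof.
have h : all (fun b => all (fun i => all (fun t0 => all (fun t1 => all (fun t2 => all (fun t3 =>
    turns_ok b i t0 t1 t2 t3) (iota 0 4)) (iota 0 4)) (iota 0 4)) (iota 0 4)) (iota 0 4))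
    [:: false; true] by vm_compute.
have bin : b \in [:: false; true] by case: b.
have lt4 t : (t < 4)%N -> t \in iota 0 4 by rewrite mem_iota.
move=> /lt4 hi /lt4 h0 /lt4 h1 /lt4 h2 /lt4 h3.
exact: (allP (allP (allP (allP (allP (allP h _ bin) _ hi) _ h0) _ h1) _ h2) _ h3).
Qed.

(** [flip q] is a reflection of Z/4. Opposite kicks modulo 8 on the two points of an orbit are what
    makes the observable a self-adjoint involution. *)
Lemma flipK (q t : nat) : (q < 4)%N -> (t < 4)%N ->
  flip q (flip q t) = t /\ (8 %| kick q t + kick q (flip q t))%N.
Proof. by case: q => [|[|[|[|]]]] // _; case: t => [|[|[|[|]]]]. Qed.

Lemma flip_lt q t : (flip q t < 4)%N. Proof. exact: ltn_pmod. Qed.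

Lemma gap_ask_lt b i k : (i < 4)%N -> (k < 4)%N -> (gap_ask (b, i) k < 4)%N.
Proof.
rewrite /gap_ask; case: b => //.
by case: i => [|[|[|[|]]]] // _; case: k => [|[|[|[|]]]].
Qed.

Lemma prod_ord4 (S : comPzSemiRingType) (F : 'I_4 -> S) :
  \prod_a F a = F (inord 0) * F (inord 1) * F (inord 2) * F (inord 3).
Proof.
rewrite !big_ord_recl big_ord0 mulr1 !mulrA.
by congr (F _ * F _ * F _ * F _); apply: val_inj; rewrite /= inordK.
Qed.

(** As [w ^+ 4 = -1], an odd target is the exponent 4, and every condition on amplitudes becomes a
    congruence modulo 8, settled by [turns_okP]. *)
Lemma gap_game_omega (R : realType) : omega_co (gap_game R) = 1.
Proof.
pose w : R[i] := cis (pi / 4).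
have w4 : w ^+ 4 = -1.
  rewrite /w; have -> : (4 = 1 + 1 + 1 + 1)%N by []; rewrite !exprD !expr1 -!cisD.
  rewrite (_ : _ + _ = pi); last by field.
  by rewrite /cis cospi sinpi; apply/eqP; rewrite eq_complex /= oppr0 !eqxx.
have w8 : w ^+ 8 = 1 by rewrite (exprM w 4 2) w4 sqrrN expr1n.
have wmod m n : (m = n %[mod 8])%N -> w ^+ m = w ^+ n.
  by move=> e; rewrite -(expr_mod m w8) e expr_mod.
have w1 n : `|w ^+ n| = 1 by rewrite normrX norm_cis expr1n.
apply: (@local_perfect R (gap_game R) 'I_4
  (fun _ q t => inord (flip (nat_of_ord q) (nat_of_ord t)))
  (fun _ q t => w ^+ kick (nat_of_ord q) (nat_of_ord t))
  [set t : {ffun 'I_4 -> 'I_4} | support (t (inord 0)) (t (inord 1)) (t (inord 2)) (t (inord 3))]%SET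
  (fun t => w ^+ phase_exp (t (inord 0)) (t (inord 1)) (t (inord 2)))) => //.
- move=> a q t; apply: val_inj; rewrite /= !inordK ?flip_lt //.
  by have [->] := flipK (ltn_ord q) (ltn_ord t).
- move=> a q t; rewrite -exprD inordK ?flip_lt //.
  by rewrite -(expr0 w); apply: wmod; have [_ /eqP ->] := flipK (ltn_ord q) (ltn_ord t).
- by apply/set0Pn; exists [ffun=> ord0]; rewrite inE !ffunE.
move=> [b i] _ t; rewrite inE => tA.
have /implyP/(_ tA)/andP[supp /eqP amp] := turns_okP b (ltn_ord i) (ltn_ord (t (inord 0)))
  (ltn_ord (t (inord 1))) (ltn_ord (t (inord 2))) (ltn_ord (t (inord 3))).
have lt4 k : (k < 4)%N -> (gap_ask (b, nat_of_ord i) k < 4)%N by apply: gap_ask_lt.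
split; first by rewrite inE !ffunE /= !inordK ?flip_lt ?lt4.
rewrite !ffunE prod_ord4 /= !inordK ?flip_lt ?lt4 // -!exprD (wmod _ _ amp) exprD exprM w4.
by rewrite xpair_eqE -val_eqE /= inordK //; case: (b).
Qed.

(** * Words of observables and derived equations *)

(** Adjacent equal letters cancel because observables are involutions. Reduced words are the normal
    forms in a free product of copies of Z/2. *)
Definition push_reduce (T : eqType) (x : T) (w : seq T) : seq T :=
  if w is y :: w' then if x == y then w' else x :: w else [:: x].

Definition reduce_word (T : eqType) (w : seq T) : seq T := foldr (@push_reduce T) [::] w.

Section Words.
Variables (R : realType) (Q : 'I_4 -> finType) (S : co_strategy R Q).
Local Notation H := (Defs.space S).

Definition word_op a (w : seq (Q a)) (x : H) : H :=
  foldr (fun j y => obs S j y) x w.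

Lemma word_op_reduce a (w : seq (Q a)) x : word_op (reduce_word w) x = word_op w x.
Proof.
elim: w => //= j w <-; rewrite /push_reduce; case: (reduce_word w) => //= k w'.
by case: eqP => // ->; rewrite obs_invol.
Qed.

Lemma word_op_comm a b (w : seq (Q a)) (k : Q b) x : a != b ->
  word_op w (obs S k x) = obs S k (word_op w x).
Proof. by move=> ab; elim: w => //= j w ->; rewrite obs_comm. Qed.

Definition tuple_op (q : forall a, Q a) : H -> H :=
  \big[comp/id]_(a < 4) (obs S (q a) : H -> H).

Definition words_op (w : forall a, seq (Q a)) : H -> H :=
  \big[comp/id]_(a < 4) (@word_op a (w a)).

Lemma tuple_op_words q w x :
  tuple_op q (words_op w x) = words_op (fun a => q a :: w a) x.
Proof.
rewrite /tuple_op /words_op !big_ord_recl !big_ord0 /=.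
by rewrite !word_op_comm.
Qed.

Definition tuples_op (s : seq (forall a, Q a)) (x : H) : H := foldr tuple_op x s.

Lemma tuples_opE s x : tuples_op s x = words_op (fun a => [seq q a | q : forall a, Q a <- s]) x.
Proof.
elim: s => [|q s IH] /=; first by rewrite /words_op !big_ord_recl big_ord0.
by rewrite IH tuple_op_words.
Qed.

Lemma eq_words_op w w' x : (forall a, reduce_word (w a) = reduce_word (w' a)) ->
  words_op w x = words_op w' x.
Proof.
move=> h; rewrite /words_op !big_ord_recl !big_ord0 /=.
by rewrite -!(word_op_reduce (w _)) !h !word_op_reduce.
Qed.

Lemma tuple_op_reduce s (d : forall a, Q a) x :
  (forall a, reduce_word [seq q a | q : forall a, Q a <- s] = [:: d a]) ->
  tuple_op d x = tuples_op s x.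
Proof.
move=> h; rewrite tuples_opE -[LHS]/(tuples_op [:: d] x) tuples_opE.
by apply: eq_words_op => a; rewrite h.
Qed.

Lemma tuple_op_isometry q (x y : H) : `|tuple_op q x - tuple_op q y| = `|x - y|.
Proof.
by rewrite /tuple_op !big_ord_recl !big_ord0 /= -!linearB !obs_norm.
Qed.

Lemma tuple_op_sign q (b : bool) (x : H) :
  tuple_op q ((-1) ^+ b *: x) = (-1) ^+ b *: tuple_op q x.
Proof. by rewrite /tuple_op !big_ord_recl !big_ord0 /= !linearZ. Qed.

End Words.

Arguments tuple_op {R Q} S q _.
Arguments tuples_op {R Q} S s _.

Section Derived.
Variables (R : realType) (G : xor_game R).
Local Notation tuple := (forall a, question G a).

(* [derived q s]: every strategy that is nearly perfect on the clauses nearly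
   answers the question tuple [q] with parity [s]. *)
Definition derived (q : tuple) (s : bool) : Prop :=
  exists K : nat, forall (S : co_strategy R (question G)) (e : R[i]),
    (forall c, 0 < weight c ->
      `|clause_op S c (state S) - (-1) ^+ target c *: state S| <= e) ->
    `|tuple_op S q (state S) - (-1) ^+ s *: state S| <= K%:R * e.

Lemma derived_clause c : 0 < weight c -> derived (ask c) (target c).
Proof. by move=> wc; exists 1%N => S e h; rewrite mul1r; exact: h. Qed.

(** Errors add up: tuple operators are isometries and commute with signs, so each factor may be
    replaced by its sign at the cost of its own error. *)
Lemma derived_tuples (s : seq (tuple * bool)) :
  (forall q b, List.In (q, b) s -> derived q b) ->
  exists K : nat, forall (S : co_strategy R (question G)) (e : R[i]),
    (forall c, 0 < weight c ->
      `|clause_op S c (state S) - (-1) ^+ target c *: state S| <= e) ->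
    `|tuples_op S (map fst s) (state S)
      - (-1) ^+ (foldr addb false (map snd s)) *: state S| <= K%:R * e.
Proof.
elim: s => [|[q b] s IH] h.
  by exists 0%N => S e _ /=; rewrite scale1r subrr normr0 mul0r.
have [K hK] := IH (fun q' b' h' => h q' b' (or_intror h')).
have [K' hK'] := h q b (or_introl erefl).
exists (K + K')%N => S e he; rewrite natrD mulrDl /=.
set x := tuples_op _ _ _; set p := foldr _ _ _.
rewrite (_ : _ - _ = (tuple_op S q x - tuple_op S q ((-1) ^+ p *: state S)) +
  (-1) ^+ p *: (tuple_op S q (state S) - (-1) ^+ b *: state S)); last first.
  by rewrite scalerBr tuple_op_sign scalerA -signr_addb addbC addrA subrK.
rewrite (le_trans (ler_normD _ _)) // lerD //; first by rewrite tuple_op_isometry hK.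
by rewrite normrZ normr_sign mul1r hK'.
Qed.

Lemma derived_reduce (s : seq (tuple * bool)) (d : tuple) :
  (forall q b, List.In (q, b) s -> derived q b) ->
  (forall a, reduce_word [seq q.1 a | q <- s] = [:: d a]) ->
  derived d (foldr addb false (map snd s)).
Proof.
move=> hs hd; have [K hK] := derived_tuples hs.
exists K => S e he; rewrite (@tuple_op_reduce _ _ _ (map fst s)); first exact: hK.
by move=> a; rewrite -map_comp -hd.
Qed.

Hypothesis w1 : omega_co G = 1.

(** Every clause contributes a nonnegative deficit, so the total deficit bounds each one. Division
    by the least positive weight [m] (capped at 1, the unit of the minimum) makes the bound uniform;
    e^2 m / 4 is what gives distance at most [e]. *)
Lemma near_perfect (e : R) : 0 < e -> exists S : co_strategy R (question G),
  forall c, 0 < weight c ->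
    `|clause_op S c (state S) - (-1) ^+ target c *: state S| <= e%:C.
Proof.
move=> e0; pose m := \big[Num.min/1]_(c : clause G | 0 < weight c) weight c.
have m0 : 0 < m.
  rewrite /m; apply: (big_ind (fun x => 0 < x)) => // x y x0 y0.
  by rewrite lt_min x0.
have d0 : 0 < e ^+ 2 * m / 4 by rewrite divr_gt0 ?mulr_gt0 ?exprn_gt0.
have [S hS] := omega_co_near w1 d0; exists S => c wc.
have mc : m <= weight c by exact: bigmin_le_cond.
rewrite -[leLHS]sqrCK // -[leRHS]sqrCK ?ler0c ?(ltW e0) //.
rewrite ler_sqrtC ?nnegrE ?exprn_ge0 ?ler0c ?(ltW e0) //.
rewrite clause_op_dist -rmorphXn lecR.
have gap : weight c / 2 * (1 - (-1) ^+ target c * complex.Re (clause_corr S c))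
    <= e ^+ 2 * m / 4.
  apply: (@le_trans _ _ (1 - success S)); last by lra.
  rewrite success_gap (bigD1 c) //= lerDl sumr_ge0 // => c' _.
  by rewrite mulr_ge0 ?divr_ge0 ?weight_ge0 // subr_ge0 clause_corr_le.
set x := 1 - _ in gap *.
have x0 : 0 <= x by rewrite subr_ge0 clause_corr_le.
rewrite -(ler_pM2l wc).
have : weight c * (2 * x) <= e ^+ 2 * m by lra.
move=> h; rewrite (le_trans h) // mulrC ler_wpM2r ?exprn_ge0 //; exact: ltW.
Qed.

(** Both signs together give 2 <= (K + K') e for every e > 0; e = 1 / (K + K' + 1) is small enough
    and always defined. *)
Lemma derived_consistent q : derived q false -> derived q true -> False.
Proof.
case=> K hK [K' hK'].
have e0 : 0 < ((K + K').+1%:R)^-1 :> R by rewrite invr_gt0.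
have [S hS] := near_perfect e0.
have h1 := hK S _ hS; have h2 := hK' S _ hS.
have : `|2 *: state S| <= (K + K')%:R * ((K + K').+1%:R^-1)%:C.
  rewrite natrD mulrDl addrC (le_trans _ (lerD h2 h1)) //.
  set x := tuple_op S q (state S).
  rewrite (_ : 2 *: state S = (x - (-1) ^+ true *: state S) -
    (x - (-1) ^+ false *: state S)); first exact: ler_normB.
  rewrite opprB addrC subrKA.
  by rewrite expr0 expr1 scale1r scaleN1r opprK scaler_nat mulr2n.
rewrite normrZ state_unit mulr1 normr_nat -(rmorph_nat (real_complex R) (K + K')).
rewrite -rmorphM -(rmorph_nat (real_complex R) 2) lecR ler_pdivlMr // -natrM ler_nat.
lia.
Qed.

End Derived.

(** * Linear equations modulo integers *)

Section TorusDuality.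
Variable R : realType.
Local Notation intm := (map_mx (intr : int -> R)).

(** With A = L D P and c = L^-1 b, the system becomes D y = c / 2 modulo integers. A row with
    nonzero d_i is solved by division; for a zero row, row i of L^-1 annihilates A, so the
    hypothesis makes c_i even and c_i / 2 an integer. *)
Lemma torus_duality (m k : nat) (A : 'M[int]_(m, k)) (b : 'cV[int]_m) :
  (forall n : 'rV[int]_m, n *m A = 0 -> (2 %| (n *m b) ord0 ord0)%Z) ->
  exists (x : 'cV[R]_k) (z : 'cV[int]_m), intm A *m x = 2^-1 *: intm b + intm z.
Proof.
move=> even; have [L Lu [P Pu [d _ AE]]] := int_Smith_normal_form A.
set D := (\matrix_(i, j) _) in AE.
pose c : 'cV[int]_m := invmx L *m b.
(* Columns beyond the number of rows get 0; where d_i = 0 the quotient is 0 by convention. *)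
pose y : 'cV[R]_k := \col_j
  if insub (j : nat) is Some i then (c i ord0)%:~R / 2 / (d`_i)%:~R else 0.
have Pu' : intm P \in unitmx by rewrite unitmxE det_map_mx rmorph_unit // -unitmxE.
have row_D (i : 'I_m) : (forall j : 'I_k, D i j = 0) -> (2 %| c i ord0)%Z.
  move=> D0; have := even (row i (invmx L)); rewrite -!row_mul !mxE => -> //.
  rewrite AE -mulmxA mulKmx // row_mul (_ : row i D = 0) ?mul0mx //.
  by apply/rowP => j; rewrite [LHS]mxE [RHS]mxE D0.
have Dy (i : 'I_m) : exists zi : int, (intm D *m y) i 0 = (c i ord0)%:~R / 2 + zi%:~R.
  have [/existsP[j Dij]|/existsPn D0] := boolP [exists j, D i j != 0]; last first.
    have D0x j : D i j = 0 by apply: contraNeq (D0 j) => ->.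
    exists (- (c i ord0 %/ 2)%Z); rewrite mxE big1 => [|j _]; last by rewrite mxE D0x mul0r.
    rewrite -{1}(divzK (row_D i D0x)) rmorphM rmorphN /= mulfK ?subrr //.
  have ij : i = j :> nat by apply: contraNeq Dij => ij; rewrite mxE (negbTE ij) mulr0n.
  have di : d`_i != 0 by move: Dij; rewrite mxE ij eqxx mulr1n.
  exists 0; rewrite addr0 mxE (bigD1 j) //= big1 ?addr0 => [|j' jj']; last first.
    rewrite !mxE (_ : (i == j' :> nat) = false) ?mulr0n ?mul0r //.
    by apply: contraNF jj' => /eqP; rewrite ij => /val_inj ->.
  have -> : intm D i j = (d`_i)%:~R by rewrite [LHS]mxE [D i j]mxE ij eqxx mulr1n.
  have -> : y j 0 = (c i ord0)%:~R / 2 / (d`_i)%:~R.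
    by rewrite [LHS]mxE -ij (_ : insub (i : nat) = Some i) //; exact: valK.
  by rewrite mulrC divfK // intr_eq0.
have /choice[z zE] := Dy.
exists (invmx (intm P) *m y), (L *m \col_i z i).
rewrite {1}AE !map_mxM -!mulmxA (mulmxA (intm P)) mulmxV // mul1mx.
have -> : intm D *m y = 2^-1 *: intm c + intm (\col_i z i).
  apply/matrixP => i j; rewrite ord1 zE [RHS]mxE [X in _ = X + _]mxE [intm c _ _]mxE.
  by rewrite [X in _ = _ + X]mxE [X in X%:~R]mxE mulrC [X in _ = _ + X%:~R]mxE.
by rewrite mulmxDr -scalemxAr -!map_mxM /c mulKVmx.
Qed.
End TorusDuality.

(** * The certificate checker *)

(* Questions of one player and question tuples, up to relabelling. *)
Notation tri := (option bool).
Notation point := (tri * tri * tri * tri)%type.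

(* In the checker below booleans are combined with [if] rather than [&&]: kernel
   reduction would otherwise evaluate both arguments. *)
Definition tri_eq (x y : tri) : bool :=
  match x, y with
  | None, None | Some false, Some false | Some true, Some true => true
  | _, _ => false
  end.

Definition point_eq (p q : point) : bool :=
  let: (p0, p1, p2, p3) := p in let: (q0, q1, q2, q3) := q in
  if tri_eq p0 q0 then if tri_eq p1 q1 then if tri_eq p2 q2 then tri_eq p3 q3
  else false else false else false.

(* The equality type of the letters of three tuples p, q, m at one player. *)
Variant pattern := AllEq | EqPQ | EqPM | EqQM | AllNeq.

Definition pat (p q m : tri) : pattern :=
  if tri_eq p q then if tri_eq p m then AllEq else EqPQ
  else if tri_eq p m then EqPM else if tri_eq q m then EqQM else AllNeq.

(** If this holds at all players, m lies in the box spanned by p and q, and the word p m q reduces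
    to the corner opposite to m. *)
Definition inbox (p q m : tri) : bool := if tri_eq p m then true else tri_eq q m.

Notation profile := (pattern * pattern * pattern * pattern)%type.

Definition pats (p q m : point) : profile :=
  let: (p0, p1, p2, p3) := p in let: (q0, q1, q2, q3) := q in
  let: (m0, m1, m2, m3) := m in
  (pat p0 q0 m0, pat p1 q1 m1, pat p2 q2 m2, pat p3 q3 m3).

Definition quint (A : Type) := (A * A * A * A * A)%type.

Definition look A (x : pattern) (t : quint A) : A :=
  let: (a, b, c, d, e) := t in
  match x with AllEq => a | EqPQ => b | EqPM => c | EqQM => d | AllNeq => e end.

Definition upd5 A (x : pattern) (f : A -> A) (t : quint A) : quint A :=
  let: (a, b, c, d, e) := t in
  match x with
  | AllEq => (f a, b, c, d, e) | EqPQ => (a, f b, c, d, e) | EqPM => (a, b, f c, d, e)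
  | EqQM => (a, b, c, f d, e) | AllNeq => (a, b, c, d, f e)
  end.

(** A set of profiles among the 5^4 possible ones, stored as a trie of depth four. *)
Definition table := quint (quint (quint (quint bool))).

Definition fill5 A (x : A) : quint A := (x, x, x, x, x).
Definition table0 : table := fill5 (fill5 (fill5 (fill5 false))).

Definition lookup (t : table) (s : profile) : bool :=
  let: (a, b, c, d) := s in look d (look c (look b (look a t))).

Definition insert (s : profile) (t : table) : table :=
  let: (a, b, c, d) := s in
  upd5 a (upd5 b (upd5 c (upd5 d (fun=> true)))) t.

(* [hit t p q m]: n p > 0, n q > 0 > n m is impossible, because its profile has
   already been refuted or because p q with m reduces to a single tuple. *)
Definition hit (t : table) (p q m : point) : bool :=
  if lookup t (pats p q m) then ~~ point_eq p q else
  let: (p0, p1, p2, p3) := p in let: (q0, q1, q2, q3) := q in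
  let: (m0, m1, m2, m3) := m in
  if inbox p0 q0 m0 then if inbox p1 q1 m1 then if inbox p2 q2 m2 then
  if inbox p3 q3 m3 then ~~ point_eq p q else false else false else false else false.

(* Tuples assumed positive and negative, and those that may still be so. *)
Record search_state := SearchState {
  spos : seq point; sneg : seq point; apos : seq point; aneg : seq point }.

Definition swap (s : search_state) := SearchState (sneg s) (spos s) (aneg s) (apos s).

Fixpoint allb A (f : A -> bool) (s : seq A) : bool :=
  if s is x :: s' then if f x then allb f s' else false else true.

(** Every triple through [q] is tested. Triples with two negative tuples are refuted by the same
    table, since irreducibility is invariant under n |-> -n. *)
Definition assign_pos (t : table) (q : point) (s : search_state) : search_state :=
  let: SearchState P M AP AM := s in
  SearchState (q :: P) M
    (seq.filter (fun x => allb (fun m => ~~ hit t q x m) M) AP)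
    (seq.filter (fun x => if point_eq x q then false else
       if allb (fun p => ~~ hit t p q x) P then allb (fun m => ~~ hit t m x q) M else false) AM).

Definition assign (t : table) (b : bool) (q : point) (s : search_state) : search_state :=
  if b then assign_pos t q s else swap (assign_pos t q (swap s)).

(* The multiset {a, b, c} contains {x, y}. *)
Definition covers (a b c x y : tri) : bool :=
  if tri_eq x a then if tri_eq y b then true else tri_eq y c
  else if tri_eq x b then if tri_eq y a then true else tri_eq y c
  else if tri_eq x c then if tri_eq y a then true else tri_eq y b else false.

(** Only multisets of letters are compared; that some order of the five tuples then cancels for all
    players is [move_word]. *)
Definition move5 (a b c x y : point) : bool :=
  let: (a0, a1, a2, a3) := a in let: (b0, b1, b2, b3) := b in
  let: (c0, c1, c2, c3) := c in let: (x0, x1, x2, x3) := x in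
  let: (y0, y1, y2, y3) := y in
  if covers a0 b0 c0 x0 y0 then if covers a1 b1 c1 x1 y1 then
  if covers a2 b2 c2 x2 y2 then covers a3 b3 c3 x3 y3 else false else false else false.

Fixpoint has_pair A (f : A -> A -> bool) (s : seq A) : bool :=
  if s is x :: s' then if has (f x) s' then true else has_pair f s' else false.

Fixpoint has_triple A (f : A -> A -> A -> bool) (s : seq A) : bool :=
  if s is x :: s' then if has_pair (f x) s' then true else has_triple f s' else false.

(** [q] would join [P]: either on the side of three tuples or on the side of two. Moves of two
    tuples against one are left to [hit], which prunes the candidates. *)
Definition has_move (P M : seq point) (q : point) : bool :=
  if has_pair (fun a b => has_pair (move5 q a b) M) P then true
  else has_triple (fun x y z => has (fun p => move5 x y z q p) P) M.

(* Weight of a value under the digit [k]: 1 by default; 2 (resp. 0) at the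
   value number [k] (resp. [k - 3]). *)
Definition shape (k : nat) (x : tri) : nat :=
  match k, x with
  | 1, None | 2, Some false | 3, Some true => 2
  | 4, None | 5, Some false | 6, Some true => 0
  | _, _ => 1
  end%N.

Definition value (a b c d : nat) (p : point) : nat :=
  let: (p0, p1, p2, p3) := p in
  (shape a p0 + (shape b p1 + (shape c p2 + shape d p3)))%coq_nat.

Definition digit (u : Decimal.uint) : nat * Decimal.uint :=
  match u with
  | Decimal.Nil => (0%N, u)
  | Decimal.D0 u => (0%N, u) | Decimal.D1 u => (1%N, u) | Decimal.D2 u => (2%N, u)
  | Decimal.D3 u => (3%N, u) | Decimal.D4 u => (4%N, u) | Decimal.D5 u => (5%N, u)
  | Decimal.D6 u => (6%N, u) | Decimal.D7 u => (7%N, u) | Decimal.D8 u => (8%N, u)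
  | Decimal.D9 u => (9%N, u)
  end.

(* Excludes one by one the candidates for sign [b]: each creates a move or is
   refuted recursively. *)
Fixpoint loop (sub : bool -> point -> search_state -> seq Number.uint -> option (seq Number.uint))
    (b : bool) (c : seq point) (s : search_state) (w : seq Number.uint) : option (seq Number.uint * search_state) :=
  if c is q :: c' then
    let: SearchState P M AP AM := s in
    let s' := if b then SearchState P M (seq.filter (fun x => ~~ point_eq x q) AP) AM
              else SearchState P M AP (seq.filter (fun x => ~~ point_eq x q) AM) in
    if (if b then has_move P M q else has_move M P q) then loop sub b c' s' w
    else if sub b q s w is Some w' then loop sub b c' s' w' else None
  else Some (w, s).

(* A certificate entry abcdu encodes a function v on tuples, additive over the
   players, and a threshold u. Balance gives sum_t n t * (v t - u) = 0; as the
   known positive tuples have v >= u, the known negative ones v <= u, one of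
   them strictly, some further tuple must be positive with v < u or negative
   with v > u. All of these are excluded in turn. *)
Fixpoint refute (t : table) (fuel : nat) (s : search_state) (w : seq Number.uint) : option (seq Number.uint) :=
  if fuel is fuel'.+1 then
    if w is Number.UIntDecimal k :: w' then
      let: (a, k) := digit k in let: (b, k) := digit k in let: (c, k) := digit k in
      let: (d, k) := digit k in let: (u, k) := digit k in
      let v := value a b c d in
      let: SearchState P M AP AM := s in
      if allb (fun p => Nat.leb u (v p)) P then if allb (fun m => Nat.leb (v m) u) M then
      if (if has (fun p => Nat.ltb u (v p)) P then true else has (fun m => Nat.ltb (v m) u) M) then
      let sub b q s w := refute t fuel' (assign t b q s) w in
      if loop sub true (seq.filter (fun x => Nat.ltb (v x) u) AP) s w' is Some (w1, s1) then
      if loop sub false (seq.filter (fun x => Nat.ltb u (v x)) (aneg s1)) s1 w1 is Some (w2, _)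
      then Some w2 else None
      else None else None else None else None
    else None
  else None.

Definition tris : seq tri := [:: None; Some false; Some true].
Definition points : seq point :=
  [seq (x, d) | x <- [seq (x, c) | x <- [seq (a, b) | a <- tris, b <- tris], c <- tris], d <- tris].

(** With p constantly [None], [std_q] and [std_m] give the representative of a profile after
    relabelling the questions of each player. *)
Definition std_q (x : pattern) : tri :=
  match x with AllEq | EqPQ => None | _ => Some false end.
Definition std_m (x : pattern) : tri :=
  match x with AllEq | EqPM => None | AllNeq => Some true | _ => Some false end.

Definition map4 A B (f : A -> B) (s : A * A * A * A) : B * B * B * B :=
  let: (a, b, c, d) := s in (f a, f b, f c, f d).

Definition swap_pat (x : pattern) :=
  match x with EqPM => EqQM | EqQM => EqPM | _ => x end.

Definition at4 A (s : A * A * A * A) (k : nat) : A :=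
  let: (a, b, c, d) := s in
  match k with 0 => a | 1 => b | 2 => c | _ => d end%N.

Definition perms4 A (s : A * A * A * A) : seq (A * A * A * A) :=
  [seq map4 (at4 s) i | i <- [seq (x, l) | x <- [seq (x, k) |
      x <- [seq (i, j) | i <- iota 0 4, j <- iota 0 4], k <- iota 0 4], l <- iota 0 4]
    & let: (i, j, k, l) := i in uniq [:: i; j; k; l]].

(* Refuting a profile refutes its images under permuting players and
   exchanging p and q. *)
Definition learn (x : profile) (t : table) : table :=
  foldr insert (foldr insert t (perms4 x)) (perms4 (map4 swap_pat x)).

Fixpoint learn_all (t : table) (xs : seq profile) (w : seq Number.uint) : option table :=
  if xs is x :: xs' then
    let p := (None, None, None, None) in
    if point_eq p (map4 std_q x) then None else
    let s := assign t true (map4 std_q x) (assign t false (map4 std_m x)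
       (assign t true p (SearchState [::] [::] points points))) in
    (* 20 bounds the nesting of case distinctions; running out of fuel makes the check fail, never
       succeed. *)
    if refute t 20 s w is Some w' then learn_all (learn x t) xs' w' else None
  else Some t.

(** * Soundness of the checker *)

Lemma tri_eqE x y : tri_eq x y = (x == y).
Proof. by case: x y => [[]|] [[]|]. Qed.

Lemma point_eqE p q : point_eq p q = (p == q).
Proof.
case: p q => [[[p0 p1] p2] p3] [[[q0 q1] q2] q3] /=; rewrite !tri_eqE.
rewrite -[in RHS]pair_eqE /pair_eq /= -[in RHS]pair_eqE /pair_eq /=.
rewrite -[in RHS]pair_eqE /pair_eq /=.
by case: (p0 == q0); case: (p1 == q1); case: (p2 == q2).
Qed.

Definition balanced (n : point -> int) := forall (a : 'I_4) (x : tri),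
  \sum_(t : point | at4 t a == x) n t = 0.

(** In terms of letter counts A = B + d at every player, so trading [A] for [B] and [d] keeps
    balance. *)
Definition move (A B : seq point) (d : point) := forall a : 'I_4,
  perm_eq [seq at4 t a | t <- A] (at4 d a :: [seq at4 t a | t <- B]).

Definition move_free (n : point -> int) := forall (A B : seq point) d,
  uniq A -> uniq B -> (1 < size A <= 3)%N ->
  {in A, forall t, 0 < n t} -> {in B, forall t, n t < 0} -> ~ move A B d.

(** Apart from balance this depends on the signs of [n] alone, which makes a finite search
    possible. *)
Definition irreducible (n : point -> int) :=
  [/\ balanced n, move_free n & move_free (fun t => - n t)].

Lemma irreducibleN n : irreducible n -> irreducible (fun t => - n t).
Proof.
case=> b i1 i2; split=> //; first by move=> a x; rewrite sumrN b oppr0.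
move=> A B d uA uB sA hA hB; apply: i1 => // t tA.
  by have := hA t tA; rewrite opprK.
by have := hB t tA; rewrite opprK.
Qed.

Lemma mk4P (A : Type) (f : 'I_4 -> A) : exists s, forall a, at4 s (nat_of_ord a) = f a.
Proof.
exists (f ord0, f (lift ord0 ord0), f (lift ord0 (lift ord0 ord0)),
  f (lift ord0 (lift ord0 (lift ord0 ord0)))).
case=> [[|[|[|[|//]]]] ?] /=; congr f; exact: val_inj.
Qed.

Lemma at4_inj (A : Type) (s s' : A * A * A * A) :
  (forall a : 'I_4, at4 s a = at4 s' a) -> s = s'.
Proof.
case: s s' => [[[a b] c] d] [[[a' b'] c'] d'] h.
have := h ord0; have := h (lift ord0 ord0).
have := h (lift ord0 (lift ord0 ord0)).
have := h (lift ord0 (lift ord0 (lift ord0 ord0))).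
by move=> /= -> -> -> ->.
Qed.

Lemma at4_map (A B : Type) (f : A -> B) s k : at4 (map4 f s) k = f (at4 s k).
Proof. by case: s => [[[a b] c] d]; case: k => [|[|[|k]]]. Qed.

Lemma at4_pats p q m k : at4 (pats p q m) k = pat (at4 p k) (at4 q k) (at4 m k).
Proof.
by case: p q m => [[[? ?] ?] ?] [[[? ?] ?] ?] [[[? ?] ?] ?]; case: k => [|[|[|k]]].
Qed.

Definition sound (t : table) := forall s, lookup t s ->
  forall n, irreducible n -> forall p q m, p != q -> 0 < n p -> 0 < n q -> n m < 0 ->
  pats p q m = s -> False.

Lemma hit_sound t n p q m : sound t -> irreducible n ->
  0 < n p -> 0 < n q -> n m < 0 -> hit t p q m = false.
Proof.
move=> st irr np nq nm; apply/negP; rewrite /hit; case: ifP => [l|_].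
  by rewrite point_eqE => pq; apply: (st _ l n irr p q m).
move=> h.
have [pq inb] : p != q /\ forall a : 'I_4, inbox (at4 p a) (at4 q a) (at4 m a).
  move: h; rewrite -point_eqE.
  case: (p) (q) (m) => [[[? ?] ?] ?] [[[? ?] ?] ?] [[[? ?] ?] ?].
  case: ifP => // h0; case: ifP => // h1; case: ifP => // h2; case: ifP => // h3 ->.
  by split=> //; case=> [[|[|[|[|//]]]] ?].
(* The corner of the box opposite to [m]: what is left of [p] and [q] once the letter of [m] is
   removed. *)
have [d dE] := mk4P (fun a : 'I_4 => if at4 m a == at4 p a then at4 q a else at4 p a).
have [_ mf _] := irr; apply: (mf [:: p; q] [:: m] d) => //.
- by rewrite /= inE pq.
- by move=> t'; rewrite !inE => /orP[] /eqP ->.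
- by move=> t'; rewrite !inE => /eqP ->.
move=> a /=; rewrite dE; have := inb a; rewrite /inbox !tri_eqE.
rewrite [at4 p a == _]eq_sym; case: eqP => [-> _|_ /eqP ->].
  by apply/seq.permP => f /=; lia.
by apply/seq.permP => f /=; lia.
Qed.

Lemma coversP a b c x y : covers a b c x y -> exists d, perm_eq [:: a; b; c] [:: d; x; y].
Proof.
by case: a => [[]|]; case: b => [[]|]; case: c => [[]|]; case: x => [[]|];
 case: y => [[]|] //= _; first [by exists None | by exists (Some true) | by exists (Some false)].
Qed.

Lemma move5_move a b c x y : move5 a b c x y -> exists d, move [:: a; b; c] [:: x; y] d.
Proof.
move=> h.
have /choice[d dP] : forall k : 'I_4, exists d, perm_eq [:: at4 a k; at4 b k; at4 c k] [:: d; at4 x k; at4 y k].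
  move=> k; apply: coversP; move: h k.
  case: (a) (b) (c) (x) (y) => [[[? ?] ?] ?] [[[? ?] ?] ?] [[[? ?] ?] ?] [[[? ?] ?] ?] [[[? ?] ?] ?] /=.
  case: ifP => // h0; case: ifP => // h1; case: ifP => // h2 h3.
  by case=> [[|[|[|[|//]]]] ?].
have [d' dE] := mk4P d; exists d' => k /=; rewrite dE; exact: dP.
Qed.

Lemma move5_sound n a b c x y : irreducible n -> uniq [:: a; b; c] -> uniq [:: x; y] ->
  {in [:: a; b; c], forall t, 0 < n t} -> {in [:: x; y], forall t, n t < 0} ->
  move5 a b c x y = false.
Proof.
move=> [_ mf _] u1 u2 h1 h2; apply/negP => /move5_move[d]; exact: mf.
Qed.

Lemma has_pairP (A : eqType) (f : A -> A -> bool) s : uniq s -> has_pair f s ->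
  exists x y, [/\ x \in s, y \in s, x != y & f x y].
Proof.
elim: s => //= x s IH /andP[xs us]; case: ifP => [/hasP[y ys fxy] _|_ /(IH us)].
  exists x, y; rewrite !inE eqxx ys orbT; split=> //.
  by apply: contraNneq xs => ->.
by case=> [x' [y [h1 h2 h3 h4]]]; exists x', y; rewrite !inE h1 h2 !orbT.
Qed.

Lemma has_tripleP (A : eqType) (f : A -> A -> A -> bool) s : uniq s -> has_triple f s ->
  exists x y z, [/\ uniq [:: x; y; z], {subset [:: x; y; z] <= s} & f x y z].
Proof.
elim: s => //= x s IH /andP[xs us]; case: ifP => [/(has_pairP us)[y [z [ys zs yz fxyz]]] _|_ /(IH us)].
  exists x, y, z; split=> //; last first.
    by move=> t; rewrite !inE => /or3P[] /eqP ->; rewrite ?eqxx ?ys ?zs ?orbT.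
  rewrite /= !inE yz !andbT negb_or; apply/andP; split; by apply: contraNneq xs => ->.
case=> [x' [y [z [h1 h2 h3]]]]; exists x', y, z; split=> // t /h2.
by rewrite inE => ->; rewrite orbT.
Qed.

Lemma has_move_sound n P M q : irreducible n -> uniq (q :: P) -> uniq M ->
  {in q :: P, forall t, 0 < n t} -> {in M, forall t, n t < 0} -> has_move P M q = false.
Proof.
move=> irr /= /andP[qP uP] uM hP hM; apply/negP; rewrite /has_move.
have nq : 0 < n q by apply: hP; rewrite mem_head.
have nP t : t \in P -> 0 < n t by move=> tP; apply: hP; rewrite inE tP orbT.
case: ifP => [/(has_pairP uP)[a [b [aP bP ab]]]|_].
  case/(has_pairP uM)=> [x [y [xM yM xy]]].
  rewrite (@move5_sound n) //= ?inE ?xy ?ab ?andbT //.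
  - by rewrite negb_or; apply/andP; split; apply: contraNneq qP => ->.
  - by move=> t; rewrite !inE => /or3P[] /eqP -> //; exact: nP.
  - by move=> t; rewrite !inE => /orP[] /eqP -> //; exact: hM.
case/(has_tripleP uM)=> [x [y [z [u3 s3 /hasP[p pP]]]]].
rewrite (@move5_sound (fun t => - n t)) //.
- exact: irreducibleN.
- by rewrite /= inE andbT; apply: contraNneq qP => ->.
- by move=> t /s3 /hM; rewrite oppr_gt0.
- by move=> t; rewrite !inE oppr_lt0 => /orP[] /eqP -> //; exact: nP.
Qed.

Definition search_inv (n : point -> int) (s : search_state) :=
  [/\ uniq (spos s) /\ uniq (sneg s),
      {in spos s, forall t, 0 < n t} /\ {in sneg s, forall t, n t < 0},
      forall t, 0 < n t -> (t \in spos s) || (t \in apos s)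
    & forall t, n t < 0 -> (t \in sneg s) || (t \in aneg s)].

Lemma inv_swap n s : search_inv n s -> search_inv (fun t => - n t) (swap s).
Proof.
case: s => P M AP AM [] /= [uP uM] [hP hM] cP cM; split=> //=.
- by split=> t ht; rewrite ?oppr_gt0 ?oppr_lt0; [exact: hM | exact: hP].
- by move=> t; rewrite oppr_gt0; exact: cM.
- by move=> t; rewrite oppr_lt0; exact: cP.
Qed.

Lemma allbE A (f : A -> bool) s : allb f s = all f s.
Proof. by elim: s => //= x s ->; case: (f x). Qed.

Lemma inv_assign_pos t n q s : sound t -> irreducible n -> search_inv n s ->
  0 < n q -> q \notin spos s -> search_inv n (assign_pos t q s).
Proof.
case: s => P M AP AM st irr [] /= [uP uM] [hP hM] cP cM nq qP; split=> /=.
- by rewrite qP.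
- by split=> // t'; rewrite inE => /orP[/eqP -> //|]; exact: hP.
- move=> x nx; rewrite inE mem_filter; case/orP: (cP x nx) => [->|->]; first by rewrite orbT.
  rewrite andbT allbE; apply/orP; right; apply/allP => m mM.
  by rewrite (hit_sound st irr) // hM.
move=> x nx; rewrite mem_filter; case/orP: (cM x nx) => [->|->] //.
rewrite andbT; apply/orP; right; rewrite point_eqE.
case: eqP => [xq|_]; first by move: nx; rewrite xq ltNge (ltW nq).
rewrite allbE; case: ifP => [_|/negP[]]; last first.
  by apply/allP => p pP; rewrite (hit_sound st irr) // hP.
rewrite allbE; apply/allP => m mM.
by rewrite (hit_sound st (irreducibleN irr)) ?oppr_gt0 ?oppr_lt0 // hM.
Qed.

Lemma inv_assign t b n q s : sound t -> irreducible n -> search_inv n s ->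
  (if b then 0 < n q else n q < 0) -> q \notin (if b then spos s else sneg s) ->
  search_inv n (assign t b q s).
Proof.
case: b => st irr ins nq qs; first exact: inv_assign_pos.
rewrite /assign; have := @inv_swap (fun x => - n x) (assign_pos t q (swap s)).
rewrite (_ : (fun x => - - n x) = n); last by apply/funext => x; rewrite opprK.
apply; apply: inv_assign_pos => //; first exact: irreducibleN.
- exact: inv_swap.
- by rewrite oppr_gt0.
Qed.

(** A candidate that creates a move or is refuted by [sub] does not have sign [b], so deleting it
    preserves the invariant. Soundness of [sub] is a hypothesis because [refute] calls the loop
    recursively. *)
Lemma loop_sound (sub : bool -> point -> search_state -> seq Number.uint -> option (seq Number.uint))
    n b c s w w' s' : irreducible n ->
  (forall q s w w', sub b q s w = Some w' -> search_inv n s ->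
     q \notin (if b then spos s else sneg s) ->
     (if b then 0 < n q else n q < 0) -> False) ->
  loop sub b c s w = Some (w', s') -> search_inv n s ->
  {in c, forall q, q \notin (if b then spos s else sneg s)} ->
  [/\ search_inv n s', spos s' = spos s, sneg s' = sneg s
    & {in c, forall q, ~~ (if b then 0 < n q else n q < 0)}].
Proof.
move=> irr hsub; elim: c s w => [|q c IH] s w /=; first by case=> _ <-.
case: s => P M AP AM hl ins hc.
set s2 := (X in loop sub b c X _) in hl.
have qs : q \notin (if b then P else M) by exact: (hc q (mem_head _ _)).
have s2E : spos s2 = P /\ sneg s2 = M by rewrite /s2; case: (b).
have done' : ~~ (if b then 0 < n q else n q < 0) -> forall w0, loop sub b c s2 w0 = Some (w', s') ->
  [/\ search_inv n s', spos s' = P, sneg s' = M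
    & {in q :: c, forall q, ~~ (if b then 0 < n q else n q < 0)}].
  move=> nq w0 h0.
  have ins2 : search_inv n s2.
    case: ins => /= h1 h2 h3 h4; rewrite /s2; case: (b) nq => nq; split=> //= t nt.
      rewrite mem_filter point_eqE; case/orP: (h3 t nt) => -> //; rewrite andbT.
      by apply/orP; right; apply: contraNneq nq => <-.
    rewrite mem_filter point_eqE; case/orP: (h4 t nt) => -> //; rewrite andbT.
    by apply/orP; right; apply: contraNneq nq => <-.
  have hc2 : {in c, forall q0, q0 \notin (if b then spos s2 else sneg s2)}.
    case: s2E => -> -> x xc; apply: hc; by rewrite inE xc orbT.
  have [h1 h2 h3 h4] := IH s2 w0 h0 ins2 hc2.
  case: s2E => e1 e2; rewrite h2 h3 e1 e2; split=> // x; rewrite inE => /orP[/eqP -> //|].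
  exact: h4.
case: ifP hl => [hm hl|_].
  apply: (done' _ w hl); apply/negP => nq; move: hm.
  case: ins => /= [[uP uM] [hP hM] _ _]; case: (b) qs nq => qP nq; apply/negP/negbT.
    rewrite (@has_move_sound n) //= ?qP // => t; rewrite inE => /orP[/eqP -> //|]; exact: hP.
  rewrite (@has_move_sound (fun t => - n t)) //=; first exact: irreducibleN.
  - by rewrite qP.
  - by move=> t; rewrite inE oppr_gt0 => /orP[/eqP -> //|]; exact: hM.
  - by move=> t; rewrite oppr_lt0; exact: hP.
case E : (sub b q _ w) => [w1|] // hl.
by apply: (done' _ w1 hl); apply/negP => nq; exact: (hsub q _ w w1 E).
Qed.

Lemma balanced_total n : balanced n -> \sum_(t : point) n t = 0.
Proof.
move=> bal; rewrite (partition_big (fun t : point => at4 t (ord0 : 'I_4)) predT) //.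
by rewrite big1 // => x _; exact: (bal ord0).
Qed.

(** Each summand of the additive function depends on one player's letter, and balance annihilates
    it; the constant u goes with the total sum. *)
Lemma balanced_value n (f : 'I_4 -> tri -> nat) (u : nat) : balanced n ->
  \sum_(t : point) n t * ((\sum_a f a (at4 t a))%N%:Z - u%:Z) = 0.
Proof.
move=> bal; under eq_bigr => t _ do rewrite mulrBr.
rewrite sumrB -mulr_suml (balanced_total bal) mul0r subr0.
under eq_bigr => t _ do rewrite (big_morph Posz PoszD (erefl _)) mulr_sumr.
rewrite exchange_big /= big1 // => a _.
rewrite (partition_big (fun t : point => at4 t a) predT) //= big1 // => x _.
rewrite (eq_bigr (fun t => n t * (f a x)%:Z)) => [|t /eqP -> //].
by rewrite -mulr_suml bal mul0r.
Qed.

Lemma violation n (f : 'I_4 -> tri -> nat) (u : nat) :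
  let v (t : point) := (\sum_a f a (at4 t a))%N in
  balanced n ->
  (exists t, (0 < n t) && (u < v t)%N || (n t < 0) && (v t < u)%N) ->
  exists t, (0 < n t) && (v t < u)%N || (n t < 0) && (u < v t)%N.
Proof.
move=> v bal [t0 ht0]; apply: contrapT => no.
have ge0 t : 0 <= n t * ((v t)%:Z - u%:Z).
  have [nt|nt|->] := ltgtP (n t) 0; last by rewrite mul0r.
    rewrite nmulr_rge0 // subr_le0 lez_nat leqNgt; apply/negP => h; apply: no.
    by exists t; rewrite nt h orbT.
  rewrite pmulr_rge0 // subr_ge0 lez_nat leqNgt; apply/negP => h; apply: no.
  by exists t; rewrite nt h.
have /eqP := balanced_value f u bal; rewrite psumr_eq0 // => /allP/(_ t0).
rewrite mem_index_enum => /(_ isT) /=; rewrite mulf_eq0 subr_eq0 eqz_nat.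
case/orP: ht0 => /andP[nt h]; [rewrite gt_eqF // gtn_eqF // | rewrite lt_eqF // ltn_eqF //].
Qed.

Lemma valueE a b c d t : value a b c d t =
  (\sum_(k < 4) shape (at4 (a, b, c, d) k) (at4 t k))%N.
Proof. by case: t => [[[? ?] ?] ?]; rewrite !big_ord_recl big_ord0 addn0. Qed.

Lemma leb_leq m k : Nat.leb m k = (m <= k)%N.
Proof. by elim: m k => [|m IH] [|k] //=; rewrite IH. Qed.

Lemma refute_sound t fuel s w w' : sound t -> refute t fuel s w = Some w' ->
  forall n, irreducible n -> search_inv n s -> False.
Proof.
move=> st; elim: fuel s w w' => //= fuel IH s [|[k|] w] w' //.
case: (digit k) => a {}k; case: (digit k) => b {}k; case: (digit k) => c {}k.
case: (digit k) => d {}k; case: (digit k) => u {}k.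
set v := value a b c d.
case: s => P M AP AM; case: ifP => // + + n irr ins.
rewrite allbE => /allP vP; case: ifP => //; rewrite allbE => /allP vM.
have {}vP p : p \in P -> (u <= v p)%N by move=> /vP; rewrite leb_leq.
have {}vM p : p \in M -> (v p <= u)%N by move=> /vM; rewrite leb_leq.
case: ifP => // strict.
case E1 : (loop _ true _ _ _) => [[w1 s1]|] //.
case E2 : (loop _ false _ _ _) => [[w2 s2]|] // _.
have hsub b' q0 s0 w0 w0' : refute t fuel (assign t b' q0 s0) w0 = Some w0' -> search_inv n s0 ->
     q0 \notin (if b' then spos s0 else sneg s0) ->
     (if b' then 0 < n q0 else n q0 < 0) -> False.
  move=> h i0 q0s nq0; apply: (IH _ _ _ h n irr); exact: inv_assign.
have hc1 : {in seq.filter (fun x => Nat.ltb (v x) u) AP, forall q,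
    q \notin (if true then spos (SearchState P M AP AM) else sneg (SearchState P M AP AM))}.
  move=> q; rewrite mem_filter /Nat.ltb leb_leq => /andP[vq _] /=.
  by apply/negP => /vP; rewrite leqNgt vq.
have [ins1 e1 e2 no1] := @loop_sound (fun b q s w => refute t fuel (assign t b q s) w) n true
  _ _ _ _ _ irr (hsub true) E1 ins hc1.
have hc2 : {in seq.filter (fun x => Nat.ltb u (v x)) (aneg s1), forall q,
    q \notin (if false then spos s1 else sneg s1)}.
  move=> q; rewrite mem_filter /Nat.ltb leb_leq e2 => /andP[vq _] /=.
  by apply/negP => /vM; rewrite leqNgt vq.
have [_ _ _ no2] := @loop_sound (fun b q s w => refute t fuel (assign t b q s) w) n false
  _ _ _ _ _ irr (hsub false) E2 ins1 hc2.
have [bal _ _] := irr; case: (ins) => /= [[uP uM] [hP hM] cP cM].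
have := @violation n (fun k => shape (at4 (a, b, c, d) k)) u bal.
move=> /= viol; case: viol.
  case: ifP strict => [/hasP[p pP]|_ /hasP[p pM]].
    by rewrite /Nat.ltb leb_leq /v valueE => h _; exists p; rewrite hP // h.
  by rewrite /Nat.ltb leb_leq /v valueE => h; exists p; rewrite hM // h orbT.
move=> x /orP[] /andP[nx vx].
  have xA : x \in AP.
    by case/orP: (cP x nx) => // /vP; rewrite /v valueE leqNgt vx.
  have /no1 : x \in seq.filter (fun x => Nat.ltb (v x) u) AP.
    by rewrite mem_filter /Nat.ltb leb_leq /v valueE vx.
  by rewrite nx.
case: ins1 => _ _ _ cM1.
have xA : x \in aneg s1.
  by case/orP: (cM1 x nx) => //; rewrite e2 => /vM; rewrite /v valueE leqNgt vx.
have /no2 : x \in seq.filter (fun x => Nat.ltb u (v x)) (aneg s1).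
  by rewrite mem_filter /Nat.ltb leb_leq /v valueE vx.
by rewrite nx.
Qed.

(** * Symmetries, and the table of refuted profiles *)

(** Permuting the players and renaming each player's questions carries moves to moves and permutes
    the balance equations. Hence one representative per profile class suffices. *)
Lemma irreducible_comp n (g : point -> point) (sg : 'I_4 -> 'I_4) (v : 'I_4 -> tri -> tri) :
  injective sg -> (forall a, injective (v a)) ->
  (forall t (a : 'I_4), at4 (g t) a = v a (at4 t (sg a))) ->
  irreducible n -> irreducible (n \o g).
Proof.
move=> sgI vI gE [bal m1 m2].
have gI : injective g.
  move=> t t' e; apply: at4_inj => a; have [sg' _ sgK] := injF_bij sgI.
  by have := congr1 (fun s => at4 s (sg' a)) e; rewrite !gE sgK => /vI.
have mv A B d : move A B d -> move (map g A) (map g B) (g d).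
  have e (C : seq point) (a : 'I_4) :
      [seq at4 t a | t : point <- map g C] = map (v a) [seq at4 t (sg a) | t : point <- C].
    by rewrite -!map_comp; apply: eq_map => t; exact: gE.
  by move=> h a; rewrite !e gE -map_cons; apply: perm_map; exact: h.
have fr k : move_free k -> move_free (k \o g).
  move=> mf A B d uA uB sA hA hB /mv; apply: mf.
  - by rewrite map_inj_uniq.
  - by rewrite map_inj_uniq.
  - by rewrite size_map.
  - by move=> _ /mapP[t tA ->]; exact: hA.
  - by move=> _ /mapP[t tA ->]; exact: hB.
split; [|exact: fr|exact: (fr (fun t => - n t))].
move=> a x; have [sg' sgK' sgK] := injF_bij sgI.
rewrite -[RHS](bal (sg' a) (v (sg' a) x)) [RHS](reindex_inj gI).
apply: eq_bigl => t; by rewrite gE sgK (inj_eq (vI _)).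
Qed.

Lemma patP p q m y : pat p q m = y -> exists v : tri -> tri,
  [/\ injective v, v None = p, v (std_q y) = q & v (std_m y) = m].
Proof.
move=> <-.
pose tab (x y z : tri) (t : tri) := match t with None => x | Some false => y | Some true => z end.
have tabI (a b c : tri) : uniq [:: a; b; c] -> injective (tab a b c).
  rewrite /= !inE negb_or andbT => /andP[/andP[ab ac] bc] [[]|] [[]|] //= e;
  by move: ab ac bc; rewrite e eqxx.
(* A question distinct from two prescribed ones completes the renaming to an injective map. *)
pose third (x y : tri) : tri := head None [seq t <- tris | t \notin [:: x; y]].
have ex (a b : tri) : a != b -> exists v, [/\ injective v, v None = a & v (Some false) = b].
  by move=> ab; exists (tab a b (third a b)); split=> //; apply: tabI; case: a b ab => [[]|] [[]|].
rewrite /pat !tri_eqE; case: (p =P q) => [->|/eqP pq].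
  case: (q =P m) => [->|/eqP qm]; last by have [v []] := ex q m qm; exists v.
  pose m' : tri := if m == None then Some false else None.
  have mm' : m != m' by rewrite /m'; case: (m) => [[]|].
  by have [v [vI vN _]] := ex m m' mm'; exists v.
case: (p =P m) => [<-|/eqP pm]; first by have [v []] := ex p q pq; exists v.
case: (q =P m) => [<-|/eqP qm]; first by have [v []] := ex p q pq; exists v.
by exists (tab p q m); split=> //; apply: tabI; rewrite /= !inE negb_or pq pm qm.
Qed.

Lemma pats_symmetry (P : profile) (n : point -> int) p q m (sg : 'I_4 -> 'I_4) :
  injective sg -> irreducible n ->
  (forall a : 'I_4, at4 (pats p q m) a = at4 P (sg a)) ->
  exists n', [/\ irreducible n', n' (None, None, None, None) = n p,
    n' (map4 std_q P) = n q & n' (map4 std_m P) = n m].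
Proof.
move=> sgI irr h.
have /choice[v vP] : forall a : 'I_4, exists v : tri -> tri,
    [/\ injective v, v None = at4 p a, v (std_q (at4 P (sg a))) = at4 q a
      & v (std_m (at4 P (sg a))) = at4 m a].
  by move=> a; apply: patP; rewrite -at4_pats.
have /choice[g gE] : forall t : point, exists s : point,
    forall a : 'I_4, at4 s a = v a (at4 t (sg a)).
  by move=> t; exact: mk4P.
exists (n \o g); split.
- by apply: (irreducible_comp sgI _ gE irr) => a; case: (vP a).
- congr n; apply: at4_inj => a; rewrite gE; case: (vP a) => _ <- _ _; congr v.
  by case: (nat_of_ord (sg a)) => [|[|[|k]]].
- by congr n; apply: at4_inj => a; rewrite gE at4_map; case: (vP a).
- by congr n; apply: at4_inj => a; rewrite gE at4_map; case: (vP a).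
Qed.

Lemma perms4P (A : eqType) (x s : A * A * A * A) : s \in perms4 x ->
  exists2 sg : 'I_4 -> 'I_4, injective sg & forall a : 'I_4, at4 s a = at4 x (sg a).
Proof.
case/mapP=> i; rewrite mem_filter => /andP[ui ii] ->.
have i4 k : (at4 i k < 4)%N.
  case/allpairsPdep: ii => t [l [ht hl ->]]; case/allpairsPdep: ht => t' [k' [ht hk ->]].
  case/allpairsPdep: ht => i' [j' [hi hj ->]].
  by move: hi hj hk hl; rewrite !mem_iota; case: k => [|[|[|k]]].
exists (fun a => Ordinal (i4 a)) => [a b /(congr1 val) /= e|a]; last by rewrite at4_map.
apply: val_inj; move: ui i4 e => + _; case: i ii => [[[i j] k] l] _ /=.
rewrite !inE !negb_or !andbT => /andP[/and3P[ij ik il] /andP[/andP[jk jl] kl]].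
case: a b => [[|[|[|[|//]]]] ?] [[|[|[|[|//]]]] ?] //= e;
by move: ij ik il jk jl kl; rewrite e eqxx.
Qed.

Definition pattern_eq_dec (x y : pattern) : {x = y} + {x <> y}.
Proof. by decide equality. Defined.

HB.instance Definition _ := hasDecEq.Build pattern (compareP pattern_eq_dec).

Lemma look_upd5 A (x y : pattern) (f : A -> A) t :
  look x (upd5 y f t) = if x == y then f (look x t) else look x t.
Proof. by case: t => [[[[a b] c] d] e]; case: x; case: y. Qed.

Lemma lookup_insert s t s' : lookup (insert s t) s' -> lookup t s' \/ s' = s.
Proof.
case: s s' => [[[a b] c] d] [[[a' b'] c'] d'].
rewrite /insert /lookup look_upd5; case: eqP => [->|_]; last by left.
rewrite look_upd5; case: eqP => [->|_]; last by left.
rewrite look_upd5; case: eqP => [->|_]; last by left.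
rewrite look_upd5; case: eqP => [->|_]; last by left.
by right.
Qed.

Lemma lookup0 s : lookup table0 s = false.
Proof. by case: s => [[[[] []] []] []]. Qed.

Lemma sound_foldr t l : sound t ->
  {in l, forall s, forall n, irreducible n -> forall p q m, p != q -> 0 < n p -> 0 < n q ->
    n m < 0 -> pats p q m = s -> False} -> sound (foldr insert t l).
Proof.
move=> st; elim: l => //= s l IH h s' /lookup_insert[|->].
  by apply: IH => x xl; apply: h; rewrite inE xl orbT.
by apply: h; rewrite mem_head.
Qed.

Lemma learn_sound x t : sound t ->
  (forall n, irreducible n -> 0 < n (None, None, None, None) ->
     0 < n (map4 std_q x) -> n (map4 std_m x) < 0 -> False) ->
  sound (learn x t).
Proof.
move=> st claim; apply: sound_foldr; first apply: sound_foldr => //.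
  move=> s /perms4P[sg sgI sE] n irr p q m _ np nq nm pE.
  have [n' [irr' e1 e2 e3]] : exists n', [/\ irreducible n',
     n' (None, None, None, None) = n p, n' (map4 std_q x) = n q & n' (map4 std_m x) = n m].
    by apply: (pats_symmetry sgI irr) => a; rewrite pE.
  by apply: (claim n' irr'); rewrite ?e1 ?e2 ?e3.
move=> s /perms4P[sg sgI sE] n irr p q m _ np nq nm pE.
have [n' [irr' e1 e2 e3]] : exists n', [/\ irreducible n',
   n' (None, None, None, None) = n q, n' (map4 std_q x) = n p & n' (map4 std_m x) = n m].
  apply: (pats_symmetry sgI irr) => a.
  have : at4 (pats p q m) a = swap_pat (at4 x (sg a)) by rewrite pE sE at4_map.
  rewrite !at4_pats; case: (at4 p a) (at4 q a) (at4 m a) (at4 x (sg a)) => [[]|] [[]|] [[]|] [];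
  by [].
by apply: (claim n' irr'); rewrite ?e1 ?e2 ?e3.
Qed.

Lemma mem_points t : t \in points.
Proof. by case: t => [[[[[]|] [[]|]] [[]|]] [[]|]]. Qed.

Lemma learn_all_sound t xs w t' : sound t -> learn_all t xs w = Some t' -> sound t'.
Proof.
elim: xs t w => [|x xs IH] t w st; first by case=> <-.
rewrite /learn_all -/learn_all point_eqE; case: ifP => // pq.
case E : (refute _ _ _ _) => [w'|] //; apply: IH; apply: learn_sound => // n irr np nq nm.
apply: (refute_sound st E irr).
apply: inv_assign => //; last first.
  by rewrite /= /assign_pos /= inE eq_sym pq.
apply: inv_assign => //; apply: inv_assign => //.
by split=> // y _; rewrite /= mem_points.
Qed.

Definition in_box (x : pattern) := match x with AllEq | EqPM | EqQM => true | _ => false end.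
Definition equal_pq (x : pattern) := match x with AllEq | EqPQ => true | _ => false end.
Definition all4 A (f : A -> bool) (s : A * A * A * A) :=
  let: (a, b, c, d) := s in [&& f a, f b, f c & f d].
Definition patterns := [:: AllEq; EqPQ; EqPM; EqQM; AllNeq].

(** A profile need not be refuted when m lies in the box of p and q, which is a move by itself, or
    when p = q. *)
Definition complete_table (t : table) : bool :=
  all (fun a => all (fun b => all (fun c => all (fun d =>
    let s := (a, b, c, d) in
    if lookup t s then true else if all4 in_box s then true else all4 equal_pq s)
  patterns) patterns) patterns) patterns.

Lemma complete_hit t p q m : complete_table t -> p != q -> hit t p q m.
Proof.
move=> ct pq; rewrite /hit point_eqE pq.
have allp x : x \in patterns by case: x.
have h s : [|| lookup t s, all4 in_box s | all4 equal_pq s].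
  case: s => [[[a b] c] d].
  have := allP (allP (allP (allP ct a (allp a)) b (allp b)) c (allp c)) d (allp d).
  by rewrite /=; case: (lookup _ _) => //; case: ifP.
have := h (pats p q m); case: (lookup _ _) => //= /orP[].
  case: p q m {pq} => [[[? ?] ?] ?] [[[? ?] ?] ?] [[[? ?] ?] ?] /=.
  have ib x y z : in_box (pat x y z) -> inbox x y z by case: x y z => [[]|] [[]|] [[]|].
  by case/and4P=> /ib -> /ib -> /ib -> /ib ->.
have e x y z : equal_pq (pat x y z) -> x = y by case: x y z => [[]|] [[]|] [[]|].
move=> h4; case/eqP: pq; move: h4.
case: p q m => [[[? ?] ?] ?] [[[? ?] ?] ?] [[[? ?] ?] ?] /=.
by case/and4P=> /e -> /e -> /e -> /e ->.
Qed.

(** If n p > 0, balance yields for each player a negative tuple that shares p's letter. Two distinct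
    negative tuples cannot coexist with p, so a single one shares all letters and equals p. *)
Lemma irreducible_eq0_of t n : sound t -> complete_table t -> irreducible n -> forall x, n x = 0.
Proof.
move=> st ct irr.
have no k p q m : irreducible k -> 0 < k p -> 0 < k q -> k m < 0 -> p = q.
  move=> irrk kp kq km; apply/eqP/negP => /negP pq.
  by have := hit_sound st irrk kp kq km; rewrite complete_hit.
have pos0 k : irreducible k -> forall x, ~ 0 < k x.
  move=> irrk p kp; have [bal _ _] := irrk.
  have ex (a : 'I_4) : exists2 m, k m < 0 & at4 m a = at4 p a.
    apply: contrapT => nom; have := bal a (at4 p a).
    rewrite (bigD1 p) //= => /eqP; rewrite gt_eqF // ltr_pwDl // sumr_ge0 // => m /andP[/eqP am _].
    by rewrite leNgt; apply/negP => km; apply: nom; exists m.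
  have [m km _] := ex ord0.
  have pm : p = m.
    apply: at4_inj => a; have [m' km' <-] := ex a.
    have -> // : m' = m.
    by apply: (no (fun t => - k t) m' m p); rewrite ?oppr_gt0 ?oppr_lt0 //; exact: irreducibleN.
  by move: kp; rewrite pm ltNge (ltW km).
move=> x; apply/eqP; rewrite eq_le; apply/andP; split; rewrite leNgt; apply/negP.
  exact: pos0.
by have := pos0 _ (irreducibleN irr) x; rewrite oppr_gt0.
Qed.

(** * The certificate and its verification *)

(** Representatives under permuting players and exchanging p and q. The order matters: a refutation
    may use all profiles learned before it. *)
Definition stages : seq profile := [:: (EqPM, EqPM, EqPM, AllNeq); (EqPQ, EqPM, EqPM,
EqPM); (AllEq, EqPM, EqPM, AllNeq); (AllEq, EqPQ, EqPM, EqPM); (AllEq, AllEq, EqPM,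
AllNeq); (AllEq, AllEq, EqPQ, EqPM); (AllEq, AllEq, AllEq, AllNeq); (EqPM, EqPM, EqQM,
AllNeq); (EqPQ, AllNeq, AllNeq, AllNeq); (EqPQ, EqPM, AllNeq, AllNeq); (EqPQ, EqPM,
EqQM, AllNeq); (EqPQ, EqPM, EqPM, AllNeq); (EqPQ, EqPM, EqPM, EqQM); (EqPQ, EqPQ,
AllNeq, AllNeq); (EqPQ, EqPQ, EqPM, AllNeq); (EqPQ, EqPQ, EqPM, EqQM); (EqPQ, EqPQ,
EqPM, EqPM); (EqPQ, EqPQ, EqPQ, AllNeq); (EqPQ, EqPQ, EqPQ, EqPM); (AllEq, AllNeq,
AllNeq, AllNeq); (AllEq, EqPM, AllNeq, AllNeq); (AllEq, EqPM, EqQM, AllNeq); (AllEq,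
EqPQ, AllNeq, AllNeq); (AllEq, EqPQ, EqPM, AllNeq); (AllEq, EqPQ, EqPM, EqQM); (AllEq,
EqPQ, EqPQ, AllNeq); (AllEq, EqPQ, EqPQ, EqPM); (AllEq, AllEq, AllNeq, AllNeq); (AllEq,
AllEq, EqPQ, AllNeq); (AllNeq, AllNeq, AllNeq, AllNeq); (EqPM, AllNeq, AllNeq, AllNeq);
(EqPM, EqQM, AllNeq, AllNeq); (EqPM, EqPM, AllNeq, AllNeq)].

(* Decimal words, whose leading zeros are significant; found by computer search. *)
Delimit Scope dec_uint_scope with digits.

Definition certificate : seq Number.uint := ([:: 00014; 50004; 00014; 01004; 11166;
66164; 66663; 00164; 02004; 10064; 00364; 66324; 21325; 66014; 12315; 20364; 60063;
64363; 64014; 01364; 56363; 56324; 06063; 52364; 50463; 54363; 04563; 50463; 06014;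
66063; 02564; 66463; 60014; 66363; 20004; 00014; 26315; 60063; 64314; 62514; 62004;
00014; 06563; 62304; 20504; 61364; 06063; 62324; 14364; 66363; 50324; 66063; 56063;
62304; 66063; 66363; 62563; 00024; 06014; 20004; 62304; 62314; 22315; 66513; 66324;
06563; 66562; 40363; 01364; 66562; 60513; 12315; 02064; 62304; 62314; 06063; 66304;
02064; 66363; 12364; 12325; 62024; 00563; 12325; 00304; 06024; 00364; 00014; 14004;
62014; 04063; 00024; 14004; 54063; 12064; 04563; 62024; 00014; 62563; 22564; 62364;
16563; 04563; 12464; 64513; 64563; 62364; 62024; 00563; 00563; 06463; 16563; 54363;
64623; 12564; 12305; 14463; 66363; 62304; 04063; 02504; 04563; 64063; 62563; 64163;
62164; 04563; 02125; 12105; 66024; 62024; 64124; 22125; 64163; 20004; 10064; 04563;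
64563; 62364; 64503; 66513; 04104; 64603; 14624; 64603; 14004; 62024; 00104; 46542;
02524; 00104; 64003; 64523; 64503; 12524; 04104; 60024; 64623; 62563; 06014; 66513;
02504; 66513; 12504; 64063; 64003; 12164; 64563; 64143; 02504; 02164; 62624; 04563;
20004; 00104; 64053; 62104; 62104; 04104; 64003; 64153; 62154; 20504; 02004; 00104;
20524; 20004; 00364; 65363; 60324; 60063; 00304; 60024; 10364; 20504; 02004; 60523;
20524; 00104; 20004; 00304; 22004; 64063; 20364; 63014; 64462; 60063; 60304; 66503;
64563; 00024; 10164; 62024; 00024; 60563; 00524; 00104; 64134; 64623; 60104; 64124;
20004; 64542; 63164; 63624; 64263; 64063; 14024; 64063; 64003; 60104; 03004; 64533;
64103; 64563; 64563; 00304; 64513; 00014; 14304; 63364; 00304; 00364; 02004; 02504;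
64314; 14004; 12064; 02004; 14364; 62024; 64263; 20004; 01064; 25304; 25463; 20463;
40063; 00364; 06063; 41364; 46314; 41563; 25463; 60014; 66063; 21564; 66063; 06014;
66363; 02004; 00014; 66314; 06314; 46314; 26514; 20064; 02504; 41563; 21025; 26004;
26524; 46563; 46662; 40563; 41304; 26304; 46513; 46462; 46353; 26304; 26304; 46563;
40563; 02004; 02054; 06114; 46563; 46613; 06503; 46563; 26524; 46563; 62014; 46114;
26304; 00014; 46063; 40563; 46353; 46053; 41563; 22315; 26024; 66063; 21564; 06563;
20504; 40563; 46563; 66363; 46063; 46114; 40563; 20125; 41004; 66063; 26024; 22125;
46503; 46104; 02004; 26024; 40563; 06004; 66562; 46503; 66314; 40104; 46104; 46623;
46603; 46003; 26024; 00104; 66562; 46103; 46123; 41503; 46114; 01524; 40124; 41024;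
06024; 06563; 21504; 46263; 46003; 21164; 46163; 41164; 22064; 20504; 20504; 20504;
21564; 21504; 02004; 20004; 22504; 00014; 40563; 22564; 41563; 22564; 64562; 02064;
40563; 46124; 46523; 46513; 66114; 40563; 26563; 36463; 46513; 46513; 41563; 20064;
22564; 26364; 20504; 40563; 46314; 66562; 46503; 66014; 40563; 20125; 26624; 46163;
22504; 42563; 40563; 20125; 26125; 46603; 41563; 22504; 00014; 46063; 06114; 26004;
40563; 26524; 46603; 22564; 26563; 20004; 22604; 00014; 44552; 44652; 02054; 20054;
06014; 26614; 06104; 26154; 22604; 26014; 42053; 46533; 06114; 46353; 22654; 20064;
20004; 60014; 64653; 60014; 20015; 62414; 06463; 66563; 60463; 66063; 66114; 20015;
66063; 20015; 66014; 62014; 20064; 20004; 04563; 64124; 66562; 64563; 64613; 60563;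
40563; 46363; 66304; 26304; 26314; 20364; 60314; 63513; 02064; 22015; 66063; 66324;
26004; 60304; 06024; 66324; 20004; 02504; 04563; 64063; 66562; 64563; 64163; 04563;
02125; 62164; 64603; 22504; 63563; 04563; 02125; 62164; 64623; 14563; 66063; 06563;
26563; 06524; 06304; 62024; 62504; 66523; 62563; 20504; 62024; 00104; 60523; 14024;
60024; 41524; 06524; 00024; 02504; 26024; 00104; 20125; 26004; 62164; 66163; 66144;
22504; 06563; 02504; 26024; 02504; 26104; 66523; 02144; 66163; 26124; 26164; 26524;
46542; 20125; 26004; 62164; 64134; 66543; 66104; 22105; 20064; 60563; 62104; 22064;
04503; 62115; 66163; 66163; 20004; 20504; 62164; 02514; 20164; 22504; 60503; 22125;
62504; 60114; 22564; 60563; 20504; 60024; 60104; 20004; 06543; 20125; 26024; 26543;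
66563; 62124; 66114; 20115; 26004; 20105; 26154; 23215; 62164; 26164; 22115; 20004;
64623; 60114; 22015; 06004; 22105; 20004; 04563; 03125; 20504; 20105; 64563; 64503;
64613; 64623; 64063; 60004; 65324; 64503; 64063; 65124; 03064; 60004; 64124; 20524;
20064; 02315; 20064; 24514; 62315; 62354; 64613; 63014; 22564; 64563; 66363; 66314;
62315; 20364; 00014; 24014; 00104; 40104; 02154; 02054; 44153; 24653; 23604; 64603;
23604; 20604; 43614; 20604; 64114; 24663; 64613; 63114; 20604; 24514; 64503; 64003;
64114; 64114; 02534; 22604; 22015; 22155; 60104; 22105; 64153; 24614; 22515; 20064;
41563; 41304; 00364; 25463; 20504; 60503; 60523; 20524; 03524; 00524; 60503; 64523;
64104; 40563; 41024; 26543; 00543; 20524; 40563; 02004; 00104; 41104; 26154; 26104;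
40104; 46003; 46114; 26154; 06503; 20004; 40503; 31524; 00104; 02024; 46063; 46363;
46413; 66513; 02364; 52364; 46563; 06024; 00104; 46134; 46114; 06104; 30004; 36524;
30164; 46263; 36164; 00024; 36524; 36524; 01125; 46263; 31064; 31164; 00024; 46063;
41164; 46003; 46563; 46003; 46063; 30004; 46063; 46503; 46063; 20364; 02514; 66503;
40314; 26463; 00304; 00364; 20004; 26004; 46563; 26004; 01064; 02004; 40563; 02164;
42164; 46114; 46563; 46114; 26104; 42104; 06014; 56063; 02125; 66543; 02064; 06104;
26534; 22064; 46114; 46552; 06063; 22564; 36014; 16364; 22564; 42104; 00014; 32115;
34153; 54613; 04014; 42614; 06014; 46613; 32215; 46653; 36104; 42614; 42164; 46014;
02015; 06114; 42115; 42653; 20004; 20004; 02115; 06114; 20004; 02654; 02064; 50463;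
02504; 62024; 00104; 60543; 64523; 30543; 06503; 21524; 31524; 62124; 00104; 64103;
64523; 06503; 30524; 00524; 46104; 30524; 00104; 40063; 00014; 60304; 25304; 45562;
65523; 00014; 30004; 20004; 44613; 45263; 41304; 46542; 46503; 42563; 32504; 50463;
56324; 20004; 26304; 04063; 54562; 50562; 03064; 30164; 00524; 32164; 02004; 10364;
00563; 32524; 46562; 52104; 02004; 23115; 64153; 54603; 64562; 00014; 64552; 64542;
23164; 03524; 64562; 23564; 06014; 20004; 00614; 06114; 02604; 02604; 26614; 62504;
02604; 26104; 66114; 20604; 40104; 42104; 46104; 26614; 22604; 40053; 46503; 06114;
40014; 46603; 41614; 40104; 40603; 20115; 02115; 20654; 40104; 20604; 40164; 41004;
41064; 26004; 20064; 40104; 22165; 40014; 20215; 20015; 41064; 46014; 21005; 21105;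
46663; 20064; 25614; 46614; 26604; 26004; 20064; 26514; 00064; 21005; 41064; 06663;
20064; 66114; 40104; 41164; 60614; 60004; 02604; 26215; 60004; 22165; 43614; 60614;
26264; 26215; 00064; 02064; 02004; 42614; 02115; 52164; 32115; 42614; 02115; 02115;
06014; 02004; 32615; 36164; 52604; 02115; 02004; 66014; 66114; 02054; 12005; 06663;
46063; 42014; 46053; 46613; 30064; 32115; 36264; 36164; 06004; 02064; 42614; 46014;
46063; 46214; 56663; 50663; 46014; 02115; 46614; 02115; 00614; 60014; 02004; 00614;
60114; 20604; 20604; 62614; 26614; 20105; 62104; 60104; 04603; 12115; 64114; 44613;
60114; 64613; 34014; 54603; 04104; 14614; 02115; 04104; 52614; 04164; 14164; 12005;
04104; 22105; 04014; 02215; 64014; 62064; 62004; 60663; 12615; 12664; 64614; 62604;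
62164; 02064; 62514; 62064; 60663; 02064; 62663; 62614; 66014; 06614; 06004; 66114;
64614; 22615; 20064; 60663; 60014; 00014; 60063; 43014; 63663; 24614; 63663; 65063;
60104; 60014; 03215; 64263; 43614; 60663; 00614; 63215; 63663; 60614; 20664; 20015;
66014; 12015; 20215; 00064; 62164; 02004; 02115; 02064; 06014; 06063; 06513; 66114;
06563; 02614; 64063; 22015; 62014; 22015; 02504; 22165; 22615; 20654; 20064; 26164;
62114; 20514; 64513; 40014; 64603; 06114; 02004; 22105; 42115; 26154; 22165; 22664;
20115; 24014; 02604; 26164; 60563; 26164; 26164; 26663; 22664; 26014; 20064; 02004;
26164; 46603; 40014; 42653; 42154; 00604; 26115; 22664; 06114; 41004; 06114; 22165;
62164; 66503; 62164; 02115; 22615; 62164; 06663; 62663; 22664; 64263; 62663; 66663;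
62654; 62115; 32615; 22664; 62014; 60014; 14004; 04014; 02604; 26164; 66163; 26164;
66063; 06663; 26164; 22664; 22015; 42014; 46613; 06663; 26614; 22664; 12015; 20004;
62164; 64603; 04014; 32654; 64653; 62654; 62115; 22664; 60014; 22015; 14004; 64063;
24014; 22105; 26164; 60304; 26164; 22664; 26614; 02004; 06104; 22664; 46214; 46613;
20054; 20004; 06663; 46653; 22664; 06014; 46014; 46503; 40014; 20105; 62164; 66503;
22105; 62614; 22664; 10004; 00164; 02064; 52164; 54563; 12025; 06014; 02064; 10115;
50164; 56104; 10015; 02604; 00614; 52614; 54653; 10115; 00264; 00614; 12205; 50004;
54053; 10205; 04663; 01604; 06663; 06614; 00204; 00624; 06204; 00064; 06663; 04124;
40663; 30604; 00264; 50663; 00614; 31265; 36624; 00164; 00064; 36004; 50014; 00614;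
02064; 06004; 00164; 06104; 01064; 00264; 51264; 15464; 10225; 11015; 30064; 50663;
11015; 01604; 00624; 51624; 15644; 10225; 00624; 11105; 51624; 51604; 11105; 05663;
00663; 06204; 06104; 00144; 00064; 06663; 11215; 40663; 30604; 00164; 00624; 00624;
32165; 36604; 30064; 00264; 00264; 56063; 06204; 00264; 16624; 16004; 66214; 06453;
62215; 16204; 56214; 06463; 06063; 02004; 01064; 06063; 56063; 06204; 01064; 50014;
16104; 16024; 50004; 54124; 16004; 06563; 06063; 01004; 06063; 02064; 56063; 06104;
56063; 00164; 16643; 06603; 06104; 06603; 11604; 56603; 06024; 01604; 52643; 16653;
16603; 06204; 16603; 04104; 56603; 06014; 02604; 51653; 06663; 10004; 00164; 04563;
52004; 02004; 04563; 02064; 10115; 50004; 62504; 02064; 10115; 64563; 00614; 12654;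
02054; 02004; 04653; 02604; 10115; 50614; 62315; 02604; 10115; 62604; 04663; 30604;
00254; 50663; 00164; 30064; 00264; 05463; 50663; 50004; 53125; 10025; 10604; 50663;
55643; 55124; 01604; 05624; 00624; 50663; 00614; 00604; 00064; 40663; 05663; 15125;
16014; 02064; 00024; 06204; 16463; 56503; 06563; 02064; 06063; 56163; 31205; 16104;
02604; 00604; 06643; 56243; 06653; 12604; 16603; 16204; 52004; 06663; 10064; 02504;
14004; 14624; 52063; 03604; 66314; 00164; 52524; 52643; 54063; 50104; 10004; 10004;
16004; 53563; 00164; 51524; 54503; 50324; 00624; 12025; 00304; 10004; 13064; 10004;
50063; 02604; 14115; 00264; 52604; 64653; 06104; 16524; 01064; 56104; 66543; 50014;
00264; 55423; 55662; 53624; 00014; 54313; 54063; 32364; 02463; 52064; 00014; 55303;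
50014; 03034; 55613; 56513; 65452; 00064; 11226; 65363; 11116; 65562; 55364; 65003;
55663; 55024; 66304; 65053; 65624; 66024; 50204; 65552; 66304; 11554; 55534; 55014;
65633; 63533; 16664; 50663; 66204; 62264; 66014; 60164; 62604; 42003; 10065; 66363;
66663; 61664; 65014; 45452; 65513; 66533; 66653; 66624; 66662; 66664; 66664;
66664])%digits.

Definition verified (xs : seq profile) (w : seq Number.uint) : bool :=
  if learn_all table0 xs w is Some t then complete_table t else false.

Lemma verified_eq0 xs w n : verified xs w -> irreducible n -> forall x, n x = 0.
Proof.
rewrite /verified; case E : (learn_all _ _ _) => [t|] // ct.
apply: (@irreducible_eq0_of t) => //; apply: learn_all_sound E.
by move=> s; rewrite lookup0.
Qed.

Lemma certificate_verified : verified stages certificate = true.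
Proof. by vm_compute. Qed.

Lemma irreducible_eq0 n : irreducible n -> forall x, n x = 0.
Proof. exact: verified_eq0 certificate_verified. Qed.

(** * From moves to parities *)

(** There are twelve words alternating between the x and the y; these six contain one of each pair
    of mutually reverse words, and reversal does not affect reduction to one letter. *)
Definition arrangements (T : Type) (x1 x2 x3 y1 y2 : T) : seq (seq T) :=
  [:: [:: x1; y1; x2; y2; x3]; [:: x1; y2; x2; y1; x3]; [:: x2; y1; x1; y2; x3];
      [:: x2; y2; x1; y1; x3]; [:: x1; y1; x3; y2; x2]; [:: x1; y2; x3; y1; x2]].

Lemma one_bad_arrangement (x1 x2 x3 y1 y2 d : tri) : perm_eq [:: x1; x2; x3] [:: d; y1; y2] ->
  (count (fun s => reduce_word s != [:: d]) (arrangements x1 x2 x3 y1 y2) <= 1)%N.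
Proof.
have tri_in (x : tri) : x \in tris by case: x => [[]|].
have h : all (fun x1 => all (fun x2 => all (fun x3 => all (fun y1 => all (fun y2 => all (fun d =>
   perm_eq [:: x1; x2; x3] [:: d; y1; y2] ==>
   (count (fun s => reduce_word s != [:: d]) (arrangements x1 x2 x3 y1 y2) <= 1)%N)
   tris) tris) tris) tris) tris) tris = true by vm_compute.
have := allP (allP (allP (allP (allP (allP h x1 (tri_in _)) x2 (tri_in _)) x3 (tri_in _))
   y1 (tri_in _)) y2 (tri_in _)) d (tri_in _).
by move/implyP.
Qed.

(** For two tuples against one, the single one goes in the middle. For three against two, four
    players spoil at most four of the six arrangements, so one is good for everybody. *)
Lemma move_word A B d : (1 < size A <= 3)%N -> move A B d ->
  exists s : seq point, perm_eq s (A ++ B) /\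
    forall a : 'I_4, reduce_word [seq at4 t a | t <- s] = [:: at4 d a].
Proof.
move=> sA mv; have /perm_size := mv ord0; rewrite /= !size_map.
case: A sA mv => [|p [|q [|r [|]]]] //= _; case: B => [|m [|m' [|]]] //= mv _.
  exists [:: p; m; q]; split; first by apply/seq.permP => f /=; lia.
  move=> a; have := mv a; rewrite /=.
  by case: (at4 p a) (at4 q a) (at4 m a) (at4 d a) => [[]|] [[]|] [[]|] [[]|].
pose bad (a : 'I_4) (s : seq point) := reduce_word [seq at4 t a | t <- s] != [:: at4 d a].
have bad1 a : (count (bad a) (arrangements p q r m m') <= 1)%N.
  exact: (@one_bad_arrangement (at4 p a) (at4 q a) (at4 r a) (at4 m a) (at4 m' a) (at4 d a) (mv a)).
have : has (fun s => [forall a, ~~ bad a s]) (arrangements p q r m m').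
  apply: contraT; rewrite -all_predC => /allP allbad.
  have : (6 <= \sum_(s <- arrangements p q r m m') \sum_(a < 4) bad a s)%N.
    rewrite -[6%N]/(size (arrangements p q r m m')) -sum1_size.
    rewrite big_seq [leqRHS]big_seq; apply: leq_sum => s /allbad /=.
    by rewrite negb_forall => /existsP[a]; rewrite negbK (bigD1 a) //= => ->.
  rewrite exchange_big /= leqNgt; case/negP.
  apply: (@leq_ltn_trans (\sum_(a < 4) 1)%N); last by rewrite sum1_card card_ord.
  apply: leq_sum => a _; apply: leq_trans (bad1 a).
  by rewrite -sum1_count [leqRHS]big_mkcond; apply: leq_sum => s _; case: (bad a s).
case/hasP=> s sin /forallP good; exists s; split; last first.
  by move=> a; apply/eqP; move: (good a); rewrite negbK.
move: sin; rewrite !inE => /or3P[|| /or4P[]] /eqP ->; apply/seq.permP => f /=; lia.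
Qed.

Lemma sum_mem (A : seq point) (P : pred point) (f : point -> int) : uniq A ->
  \sum_(t | P t) (t \in A)%:Z * f t = \sum_(t <- A | P t) f t.
Proof.
move=> uA; rewrite big_mkcond [RHS]big_mkcond (big_uniq _ uA) [RHS]big_mkcond.
by apply: eq_bigr => t _; case: (P t); case: (t \in A); rewrite ?mul1r ?mul0r.
Qed.

Definition transport (A B : seq point) (d : point) (n : point -> int) (t : point) : int :=
  n t - (t \in A)%:Z + (t \in B)%:Z + (t == d)%:Z.

Lemma sum_transport A B d n (P : pred point) (f : point -> int) : uniq A -> uniq B ->
  \sum_(t | P t) transport A B d n t * f t =
  \sum_(t | P t) n t * f t - \sum_(t <- A | P t) f t + \sum_(t <- B | P t) f t +
  \sum_(t <- [:: d] | P t) f t.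
Proof.
move=> uA uB; rewrite -(sum_mem P f uA) -(sum_mem P f uB) -(@sum_mem [:: d]) //.
rewrite -sumrB -!big_split /=; apply: eq_bigr => t _.
by rewrite /transport inE !(mulrDl, mulNr).
Qed.

Lemma transport_balanced A B d n : uniq A -> uniq B -> move A B d ->
  balanced n -> balanced (transport A B d n).
Proof.
move=> uA uB mv bal a x.
have := @sum_transport A B d n (fun t => at4 t a == x) (fun=> 1) uA uB.
under eq_bigr => t _ do rewrite mulr1.
under [X in X - _]eq_bigr => t _ do rewrite mulr1.
rewrite bal => ->; have /seq.permP/(_ (pred1 x)) := mv a.
rewrite /= !count_map => e.
have cnt (s : seq point) : \sum_(t <- s | at4 t a == x) 1 = (count (fun t => at4 t a == x) s)%:Z.
  by rewrite -sum1_count (big_morph Posz PoszD (erefl _)).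
rewrite !cnt [X in _ - X](congr1 Posz e) /= addn0 PoszD; ring.
Qed.

(** Every coefficient in [A] or [B] moves one step towards 0, a gain of at least two, while [d]
    costs at most one. *)
Lemma transport_size A B d n : uniq A -> uniq B -> (1 < size A)%N ->
  {in A, forall t, 0 < n t} -> {in B, forall t, n t < 0} ->
  (\sum_t `|transport A B d n t| < \sum_t `|n t|)%N.
Proof.
move=> uA uB sA hA hB.
have cnt (s : seq point) : uniq s -> (\sum_t (t \in s) = size s)%N.
  by move=> us; rewrite -(card_uniqP us) -sum1_card [RHS]big_mkcond; apply: eq_bigr => t _; case: (t \in s).
have : (\sum_t `|transport A B d n t| + \sum_t (t \in A) <= \sum_t `|n t| + \sum_t (t \in [:: d]))%N.
  rewrite -!big_split /=; apply: leq_sum => t _; rewrite /transport inE.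
  have := hA t; have := hB t; case: (t \in A); case: (t \in B) => hb ha; [have := ha isT; have := hb isT | have := ha isT | have := hb isT | ]; case: (t == d); lia.
by rewrite !cnt //= addn1 => /(leq_trans (leq_add (leqnn _) sA)); rewrite addn2 ltnS.
Qed.

Lemma dvd2_parity (x : int) (a b : nat) :
  (2 %| x - a%:Z + b%:Z + (odd (a + b))%:Z)%Z = (2 %| x)%Z.
Proof. by rewrite -modn2; lia. Qed.

(** [C] stands for the derivable signs; only their consistency and their closure under reduced words
    are used. Induction on the l1-norm: the tuple [d] produced by a move is again derivable, with
    the parity of all tuples of the move. *)
Lemma balanced_even (C : point -> bool -> Prop) :
  (forall t, C t false -> C t true -> False) ->
  (forall (s : seq (point * bool)) d, (forall t b, (t, b) \in s -> C t b) ->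
     (forall a : 'I_4, reduce_word [seq at4 q.1 a | q <- s] = [:: at4 d a]) ->
     C d (foldr addb false [seq q.2 | q <- s])) ->
  forall n : point -> int, balanced n -> (forall t, n t != 0 -> exists b, C t b) ->
  (2 %| \sum_t n t * `[< C t true >]%:Z)%Z.
Proof.
move=> consistent closed; set sg := fun t => `[< C t true >].
have sgE t b : C t b -> sg t = b.
  case: b => h; first exact/asboolP.
  by apply/asboolP => h'; exact: (consistent t).
have sgC t b : C t b -> C t (sg t) by move=> h; rewrite (sgE _ _ h).
move=> n; have [k] := ubnP (\sum_t `|n t|)%N; elim: k n => // k IH n nk bal dom.
suff step (n0 : point -> int) A B d : (\sum_t `|n0 t| < k.+1)%N -> balanced n0 ->
    (forall t, n0 t != 0 -> exists b, C t b) -> uniq A -> uniq B -> (1 < size A <= 3)%N ->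
    {in A, forall t, 0 < n0 t} -> {in B, forall t, n0 t < 0} -> move A B d ->
    (2 %| \sum_t n0 t * (sg t)%:Z)%Z.
  (* An irreducible [n] is 0; otherwise [n] or its negative admits a move, and negation does not
     change the parity of the sum. *)
  have [irr|red] := EM (irreducible n).
    by rewrite big1 // => t _; rewrite (irreducible_eq0 irr) mul0r.
  apply: contrapT => nd; apply: red; split=> //; move=> A B d uA uB sA hA hB mv; apply: nd.
    exact: (step n A B d).
  rewrite -[\sum_t n t * _]opprK rpredN -sumrN.
  under eq_bigr => t _ do rewrite -mulNr.
  apply: (step (fun t => - n t) A B d) => //.
  - by under eq_bigr => t _ do rewrite abszN.
  - by move=> a x; rewrite sumrN bal oppr0.
  - by move=> t; rewrite oppr_eq0; exact: dom.
move=> {n nk bal dom} n0k bal dom uA uB sA hA hB mv.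
have [s [sAB sd]] := move_word sA mv.
have Cs t : t \in A ++ B -> C t (sg t).
  rewrite mem_cat => tAB; have [|b /sgC //] := dom t.
  by case/orP: tAB => [/hA|/hB]; [move/gt_eqF->|move/lt_eqF->].
have Cd : C d (foldr addb false [seq sg t | t <- s]).
  have := closed [seq (t, sg t) | t <- s] d; rewrite -!map_comp; apply.
    by move=> t b /mapP[x xs [-> ->]]; apply: Cs; rewrite -(perm_mem sAB).
  by move=> a; rewrite -map_comp; exact: sd.
have sgd : sg d = odd (\sum_(t <- A) sg t + \sum_(t <- B) sg t).
  rewrite (sgE _ _ Cd) -big_cat -(perm_big _ sAB) /=.
  by elim: (s) => [|t s' IHs] /=; rewrite ?big_nil ?big_cons // oddD oddb IHs.
have := IH (transport A B d n0) _ (transport_balanced uA uB mv bal).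
rewrite (@sum_transport A B d n0 predT) // big_cons big_nil /=.
have cnt (l : seq point) : \sum_(t <- l) (sg t)%:Z = (\sum_(t <- l) sg t)%N%:Z.
  by rewrite (big_morph Posz PoszD (erefl _)).
rewrite !cnt -/(sg d) sgd addr0 dvd2_parity; apply.
  rewrite ltnS in n0k; apply: (leq_trans _ n0k); have /andP[A1 _] := sA; exact: transport_size.
move=> t; rewrite /transport; have [-> _|/negP td] := eqVneq t d; first by eexists; exact: Cd.
have [tA|tA] := boolP (t \in A); first by exists (sg t); apply: Cs; rewrite mem_cat tA.
have [tB|tB] := boolP (t \in B); first by exists (sg t); apply: Cs; rewrite mem_cat tB orbT.
by rewrite subr0 !addr0; exact: dom.
Qed.

(** * From parities to angles *)

Lemma sum_enum_rank (T : finType) (V : nmodType) (F : 'I_#|T| -> V) :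
  \sum_i F i = \sum_t F (enum_rank t).
Proof. by rewrite (reindex enum_rank) //; apply: onW_bij; exact: enum_rank_bij. Qed.

Lemma cis_int2pi (R : realType) (z : int) : cis (2 * pi * z%:~R : R) = 1.
Proof.
suff nat1 (n : nat) : cis (2 * pi * n%:R : R) = 1.
  case: z => n; first exact: nat1.
  by rewrite NegzE rmorphN mulrN cisN nat1 invr1.
elim: n => [|n IH]; first by rewrite mulr0 cis0.
by rewrite -[n.+1]addn1 natrD mulrDr mulr1 cisD IH mul1r mulr_natl /cis cos2pi sin2pi.
Qed.

(** Duality for the incidence matrix of tuples against pairs (player, question). Its solution
    measures angles in full turns, so the parity b becomes b / 2. *)
Lemma parity_angles (R : realType) (C : point -> bool -> Prop) :
  (forall t, C t false -> C t true -> False) ->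
  (forall (s : seq (point * bool)) d, (forall t b, (t, b) \in s -> C t b) ->
     (forall a : 'I_4, reduce_word [seq at4 q.1 a | q <- s] = [:: at4 d a]) ->
     C d (foldr addb false [seq q.2 | q <- s])) ->
  exists theta : 'I_4 -> tri -> R, forall t b, C t b ->
    cis (\sum_a theta a (at4 t a)) = (-1) ^+ b.
Proof.
move=> consistent closed; pose dom t := `[< exists b, C t b >].
pose sg t := `[< C t true >].
have sgE t b : C t b -> sg t = b.
  case: b => h; first exact/asboolP.
  by apply/asboolP => h'; exact: (consistent t).
pose A := \matrix_(i < #|{: point}|, j < #|{: 'I_4 * tri}|)
  (if dom (enum_val i) then (at4 (enum_val i) (enum_val j).1 == (enum_val j).2)%:Z else 0).
pose b := \col_(i < #|{: point}|) (if dom (enum_val i) then (sg (enum_val i))%:Z else 0).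
have [n nA|x [z xz]] := @torus_duality R _ _ A b.
  (* Rows of tuples without a sign are zero and leave [n] free there; truncation yields a balanced
     combination of tuples that carry one. *)
  pose n' t := if dom t then n ord0 (enum_rank t) else 0.
  have -> : (n *m b) ord0 ord0 = \sum_t n' t * (sg t)%:Z.
    rewrite mxE sum_enum_rank; apply: eq_bigr => t _; rewrite mxE enum_rankK /n'.
    by case: (dom t); rewrite ?mulr0 ?mul0r.
  apply: (balanced_even consistent closed) => [a x|t]; last first.
    by rewrite /n' /dom; case: asboolP; rewrite ?eqxx.
  have /matrixP/(_ ord0 (enum_rank (a, x))) := nA.
  rewrite !mxE sum_enum_rank => h; rewrite big_mkcond -[RHS]h /=; apply: eq_bigr => t _.
  by rewrite mxE !enum_rankK /n' /=; case: (dom t); case: eqP; rewrite ?mulr0 ?mulr1 ?mul0r.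
exists (fun a y => 2 * pi * x (enum_rank (a, y)) ord0) => t c Ct.
have domt : dom t by apply/asboolP; exists c.
pose F (a : 'I_4) (y : tri) : R := (at4 t a == y)%:R * x (enum_rank (a, y)) ord0.
have Ax : (map_mx intr A *m x) (enum_rank t) ord0 = \sum_(a < 4) x (enum_rank (a, at4 t a)) ord0.
  rewrite mxE sum_enum_rank (eq_bigr (fun p => F p.1 p.2)) => [|[a y] _]; last first.
    by rewrite !mxE !enum_rankK domt /F /=; case: eqP.
  rewrite -(pair_bigA _ F) /=; apply: eq_bigr => a _.
  rewrite (bigD1 (at4 t a)) //= /F eqxx mul1r big1 ?addr0 // => y /negPf ny.
  by rewrite eq_sym ny mul0r.
rewrite -mulr_sumr -Ax xz !mxE enum_rankK domt (sgE _ _ Ct) mulrDr cisD cis_int2pi mulr1.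
rewrite mulrAC mulrA mulfV ?pnatr_eq0 // mul1r.
by case: (c); rewrite ?mul0r ?cis0 // mul1r /cis cospi sinpi; apply/eqP; rewrite eq_complex /= oppr0 !eqxx.
Qed.

Lemma reduce_wordP (T : eqType) (w : seq T) : sorted (fun x y => x != y) (reduce_word w).
Proof.
elim: w => //= x w; case: (reduce_word w) => //= y r h.
by case: eqVneq => [_|xy] /=; [exact: path_sorted h | rewrite xy].
Qed.

Lemma push_reduceK (T : eqType) (x : T) w :
  sorted (fun x y => x != y) w -> push_reduce x (push_reduce x w) = w.
Proof.
case: w => [|y w] /=; first by rewrite eqxx.
case: eqVneq => [->|_] /=; last by rewrite eqxx.
by case: w => //= z w /andP[/negPf ->].
Qed.

(** Cancellations made before a renaming survive it, even when [f] identifies letters. This is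
    needed because several labels may decode to the same question. *)
Lemma reduce_word_map (T U : eqType) (f : T -> U) w :
  reduce_word (map f (reduce_word w)) = reduce_word (map f w).
Proof.
elim: w => //= x w <-; case: (reduce_word w) => //= y r.
by case: eqVneq => // ->; rewrite push_reduceK //; exact: reduce_wordP.
Qed.

(** * Assembling the theorem *)

Lemma labelling (T : finType) (J : {set T}) : (#|J| <= 3)%N -> J != finset.set0 ->
  exists (lab : tri -> T) (code : T -> tri), {in J, cancel code lab}.
Proof.
move=> J3 /set0Pn[j0 _].
(* Positions 0, 1, 2 in [enum J] are labelled [None], [Some false], [Some true]; labels beyond the
   size of [J] decode to the default [j0]. *)
exists (fun x => nth j0 (enum J) (if x is Some b then (nat_of_bool b).+1 else 0%N)).
exists (fun j => if index j (enum J) is i.+1 then Some (i == 1)%N else None) => j jJ /=.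
have : (index j (enum J) < 3)%N.
  by apply: leq_trans J3; rewrite cardE index_mem mem_enum.
have := nth_index j0 (_ : j \in enum J); rewrite mem_enum => /(_ jJ).
by case: (index j (enum J)) => [|[|[|]]].
Qed.

Lemma omega_co_merp (R : realType) (G : xor_game R) :
  (forall a, (#|active_questions G a| <= 3)%N) -> omega_co G = 1 -> has_perfect_merp G.
Proof.
move=> act3 w1.
have [c0 c0P] : exists c : clause G, 0 < weight c.
  apply: contrapT => no; have := weight_sum1 G; rewrite big1 => [/eqP|c _].
    by rewrite eq_sym oner_eq0.
  by apply/eqP; rewrite eq_le weight_ge0 andbT leNgt; apply/negP => h; apply: no; exists c.
have active c a : 0 < weight c -> ask c a \in active_questions G a.
  by move=> cP; rewrite inE; apply/existsP; exists c; rewrite cP /=.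
have act0 a : active_questions G a != finset.set0.
  by apply/set0Pn; exists (ask c0 a); exact: active.
have labs a : {lc : (tri -> question G a) * (question G a -> tri) |
    {in active_questions G a, cancel lc.2 lc.1}}.
  apply: cid; have [lab [code h]] := labelling (act3 a) (act0 a).
  by exists (lab, code).
pose lab a := (sval (labs a)).1; pose code a := (sval (labs a)).2.
have labK a : {in active_questions G a, cancel (code a) (lab a)} := svalP (labs a).
(* All 81 label tuples are decoded, so [C] makes sense for surplus labels as well. *)
pose C (t : point) := @derived R G (fun a => lab a (at4 t a)).
have [t|s d hs hd|theta htheta] := @parity_angles R C.
- exact: derived_consistent.
- have := @derived_reduce R G [seq ((fun a => lab a (at4 q.1 a)), q.2) | q <- s]
    (fun a => lab a (at4 d a)).
  rewrite /C -map_comp; apply=> [q b|a].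
    move: hs; elim: s {hd} => //= -[t b'] s IH hs [[<- <-]|h].
      by apply: hs; rewrite mem_head.
    by apply: IH => // t'' b'' h''; apply: hs; rewrite inE h'' orbT.
  rewrite -map_comp (_ : [seq _ | q <- s] = map (lab a) [seq at4 q.1 a | q <- s]).
    by rewrite -reduce_word_map hd.
  by rewrite -map_comp.
(* Inactive questions also receive some label's angle; they occur in no clause of positive
   weight. *)
exists (fun a j => theta a (code a j)) => c cP; apply/merp_win1.
have [t tE] := mk4P (fun a => code a (ask c a)).
rewrite (eq_bigr (fun a => theta a (at4 t a))) => [|a _]; last by rewrite tE.
apply: htheta; rewrite /C (_ : (fun a => _) = ask c); first exact: derived_clause.
by apply: functional_extensionality_dep => a; rewrite tE labK // active.
Qed.

Theorem theorem1p1 (R : realType) :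
  [/\ (forall G : xor_game R,
         (forall a : 'I_4, (#|active_questions G a| <= 3)%N) ->
         (omega_co G = 1%R <-> has_perfect_merp G)),
      (exists G : xor_game R,
         (forall a : 'I_4, #|active_questions G a| = 4%N) /\ co_merp_gap G)
    & gap_within R 4 /\ (forall n : nat, gap_within R n -> (4 <= n)%N)].
Proof.
have gap : co_merp_gap (gap_game R) := conj (gap_game_omega R) (@gap_game_no_merp R).
split=> [G act3||].
- split; [exact: omega_co_merp | exact: merp_omega_co].
- by exists (gap_game R); split=> // a; exact: gap_game_active.
split; first by exists (gap_game R); split=> // a; rewrite gap_game_active.
move=> n [G [actn [w1 no_merp]]]; rewrite leqNgt; apply/negP => n3; apply: no_merp.
by apply: omega_co_merp w1 => a; exact: leq_trans (actn a) n3.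
Qed.
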